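(* Let $\mathfrak{g}=\mathfrak{sl}(n,\mathbb{C})$ with a Chevalley basis, let $\phi:\mathfrak{g}\to\mathfrak{gl}(V)$ be the irreducible representation with highest weight $\lambda$, let $\mu_1,\dots,\mu_s$ be the distinct dominant weights of $V$, and let $k_i=|O_{\mu_i}|$ be the size of the orbit of $\mu_i$ under the Weyl group $\mathscr{W}$. Then $$f_\phi(z_0,L)=(f_{\mu_1})^{m_\lambda(\mu_1)}\cdots(f_{\mu_s})^{m_\lambda(\mu_s)},$$ with each $f_{\mu_i}$ irreducible of degree $k_i$.
   Context: $f_\phi(z_0,L)=\det(z_0I+\phi(L))$, viewed as a polynomial in $z_0$ and the coordinates of $L$ with respect to the Chevalley basis. $m_\lambda(\mu)$ is the dimension of the $\mu$-weight space of $V$. $\mathfrak{h}$ is the diagonal Cartan subalgebra, $\mathscr{W}\cong\mathfrak{S}_n$ acts on $\mathfrak{h}^*$, $O_\mu=\mathscr{W}\mu$. Orbital factor: for diagonalizable $L$ with eigenvalues $\theta_1,\dots,\theta_n$, $f_\mu(z_0,L)=\prod_{\nu\in O_\mu}(z_0+\nu(\mathrm{diag}(\theta_1,\dots,\theta_n)))$; this is well defined and extends uniquely to a polynomial function on $\mathbb{C}\times\mathfrak{g}$. Irreducibility is over $\mathbb{C}$ in the polynomial ring in $z_0$ and the coordinates of $L$. *)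

(* Defs.v *)
From HB Require Import structures.
From mathcomp Require Import all_boot all_order all_algebra all_fingroup.
From mathcomp Require Import mpoly.
Set Implicit Arguments.
Unset Strict Implicit.
Unset Printing Implicit Defensive.
Import Order.TTheory GRing.Theory.
Local Open Scope ring_scope.

Section Defs.
Variables (F : fieldType) (n N : nat).

Definition in_sl (X : 'M[F]_n) : bool := \tr X == 0.

Definition Hmx (j : nat) : 'M[F]_n :=
  \matrix_(a, b) (if a == b then ((val a == j)%:R - (val a == j.+1)%:R) else 0).

Definition chev : seq 'M[F]_n :=
  [seq delta_mx p.1 p.2 | p <- enum [pred p : 'I_n * 'I_n | p.1 != p.2]]
  ++ [seq Hmx j | j <- iota 0 n.-1].

(* number of Chevalley basis elements, dim sl(n) = n^2 - 1 *)
Definition dsl : nat := (n * n).-1.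

Definition chevb (i : nat) : 'M[F]_n := nth 0 chev i.

Definition Lof (c : 'I_dsl -> F) : 'M[F]_n := \sum_(i < dsl) c i *: chevb i.

(* polynomial ring in z0 (variable ord0) and the dsl Chevalley coordinates *)
Definition PR := {mpoly F[dsl.+1]}.

Definition evpt (z0 : F) (c : 'I_dsl -> F) : 'I_dsl.+1 -> F :=
  fun j => if unlift ord0 j is Some i then c i else z0.

Definition is_lie_rep (phi : 'M[F]_n -> 'M[F]_N) : Prop :=
  (forall a X Y, in_sl X -> in_sl Y -> phi (a *: X + Y) = a *: phi X + phi Y) /\
  (forall X Y, in_sl X -> in_sl Y ->
     phi (X *m Y - Y *m X) = phi X *m phi Y - phi Y *m phi X).

(* irreducible: V = F^N nonzero, and the only subspaces (given as column
   spaces, i.e. row spaces of U with columns U^T) stable under all phi X,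
   X in sl(n), are 0 and V *)
Definition irreducible_rep (phi : 'M[F]_n -> 'M[F]_N) : Prop :=
  (0 < N)%N /\
  forall U : 'M[F]_N, (forall X, in_sl X -> stablemx U (phi X)^T) ->
    (U == 0) || row_full U.

(* A weight mu in h^* is represented by the unique w : 'rV_n with
   sum_i w_i = 0 such that mu(diag(t)) = sum_i w_i t_i on trace-zero t. *)
Definition wval (w : 'rV[F]_n) (H : 'M[F]_n) : F := \sum_i w 0 i * H i i.

Definition is_weight_rep (w : 'rV[F]_n) : bool := \sum_i w 0 i == 0.

(* weight space V_mu = {v | phi(H) v = mu(H) v for all H in h}, computed
   through the basis H_0, ..., H_{n-2} of h (as a row space of transposes) *)
Definition wspace (phi : 'M[F]_n -> 'M[F]_N) (w : 'rV[F]_n) : 'M[F]_N :=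
  (\bigcap_(j < n.-1) eigenspace (phi (Hmx j))^T (wval w (Hmx j)))%MS.

Definition wmult (phi : 'M[F]_n -> 'M[F]_N) (w : 'rV[F]_n) : nat :=
  \rank (wspace phi w).

Definition dominant (w : 'rV[F]_n) : Prop :=
  forall j : nat, (j < n.-1)%N -> exists k : nat, wval w (Hmx j) = k%:R.

(* Weyl group S_n acting on weights by permuting coordinates *)
Definition wact (s : 'S_n) (w : 'rV[F]_n) : 'rV[F]_n := \row_i w 0 (s i).

Definition worbit (w : 'rV[F]_n) : seq 'rV[F]_n :=
  undup [seq wact s w | s <- enum {perm 'I_n}].

Definition diag_with (L : 'M[F]_n) (theta : 'rV[F]_n) : Prop :=
  exists P : 'M[F]_n, P \in unitmx /\ L = invmx P *m diag_mx theta *m P.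

Definition fphi (phi : 'M[F]_n -> 'M[F]_N) : PR :=
  \det (\matrix_(a, b) ('X_ord0 *+ (a == b)%N +
        \sum_(i < dsl) 'X_(lift ord0 i) * ((phi (chevb i)) a b)%:MP)
        : 'M[PR]_N).

Definition is_orbital_factor (w : 'rV[F]_n) (f : PR) : Prop :=
  forall (z0 : F) (c : 'I_dsl -> F) (theta : 'rV[F]_n),
    diag_with (Lof c) theta ->
    f.@[evpt z0 c] = \prod_(nu <- worbit w) (z0 + \sum_i nu 0 i * theta 0 i).

End Defs.

Definition irreducible_elt (R : idomainType) (p : R) : Prop :=
  p != 0 /\ p \isn't a GRing.unit /\
  forall q r : R, p = q * r -> q \is a GRing.unit \/ r \is a GRing.unit.

(* Main.v *)
(** The weights of [phi] form a multiset stable under the Weyl group: for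
    [E = v e_k^T] with [v_k = 0], [phi E] is nilpotent and its exponential
    intertwines [phi X] and [phi ((1 + E) X (1 - E))], while Gaussian elimination
    writes every invertible matrix as a product of such transvections times a
    diagonal matrix.  Hence [det (z0 + phi L)] only depends on the eigenvalues of
    [L] when [L] is diagonalizable, and equals there the product of the values of
    the orbital factors; a discriminant argument extends this to all [L].  The
    orbital factors are polynomials by the fundamental theorem on symmetric
    polynomials, applied to the coefficients of the characteristic polynomial of
    the generic [L].

    For irreducibility, let [f_w = q r].  Along a one-parameter group of
    transvections [q r] is constant in the parameter, hence so is [q]: thus [q]
    and [r] are invariant under conjugation.  Restricted to [z0 = - w(L)] with [L]
    diagonal, [q r] vanishes, so one factor, say [q], vanishes there, and by
    invariance on every hyperplane [z0 = - nu(L)] with [nu] in the orbit of [w].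
    So [q] has at least [|O_w| = deg f_w] roots in [z0] for a generic [L], and [r]
    is constant. *)
Require Import Defs.
From HB Require Import structures.
From mathcomp Require Import all_boot all_order all_algebra all_fingroup.
From mathcomp Require Import mpoly ring zify.
Set Implicit Arguments.
Unset Strict Implicit.
Unset Printing Implicit Defensive.
Import GRing.Theory.
Local Open Scope ring_scope.

(** * Polynomials vanishing at every point in characteristic 0 *)

Section VanishingPolynomials.
Variables (F : fieldType) (charF0 : [pchar F] =i pred0).

Lemma natr_pchar0_inj : injective (fun k : nat => k%:R : F).
Proof.
have h := (pcharf0P F).1 charF0.
have aux i j : (i <= j)%N -> i%:R = j%:R :> F -> i = j.
  move=> leij /esym/eqP; rewrite -subr_eq0 -natrB // h subn_eq0 => leji.
  by apply/eqP; rewrite eqn_leq leij.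
move=> i j eij; case/orP: (leq_total i j) => [/aux|/aux/(_ (esym eij))/esym] //.
by apply.
Qed.

Lemma natS_neq0 k : (k.+1%:R != 0 :> F).
Proof. by rewrite ((pcharf0P F).1 charF0). Qed.

(** In characteristic 0 the first [size p] naturals are distinct in [F], which is one root too many
    for a nonzero [p]. *)
Lemma poly_vanish (p : {poly F}) : (forall x, p.[x] = 0) -> p = 0.
Proof.
move=> p0; apply/eqP/negPn/negP => pn0.
pose rs := [seq k%:R : F | k <- iota 0 (size p)].
have := @max_poly_roots _ p rs pn0.
rewrite size_map size_iota ltnn => /(_ _ _)/negP; apply => //.
  by apply/allP => x _; rewrite rootE p0.
by rewrite map_inj_uniq ?iota_uniq //; apply: natr_pchar0_inj.
Qed.

(** Together with [m ord_max] this determines [m]; it is the exponent that [muni] leaves in the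
    coefficients when it singles out the last variable. *)
Definition mrestr n (m : 'X_{1..n.+1}) : 'X_{1..n} :=
  [multinom m (widen_ord (leqnSn n) i) | i < n].

Lemma coef_muni n (p : {mpoly F[n.+1]}) k m : (muni p)`_k@_(mrestr m) =
  \sum_(m' <- msupp p | (m' ord_max == k) && (mrestr m' == mrestr m)) p@_m'.
Proof.
rewrite muniE coef_sum raddf_sum /= [RHS]big_mkcond; apply: eq_bigr => m' _.
rewrite coefZ coefXn eq_sym; case: eqP => _ /=; last by rewrite mulr0 mcoeff0.
by rewrite mulr1 mcoeffZ mcoeffX -/(mrestr m'); case: eqP => _; rewrite ?mulr1 ?mulr0.
Qed.

(** A monomial is recovered from its last exponent and its restriction, so the sum in [coef_muni]
    has a single term. *)
Lemma muni_inj0 n (p : {mpoly F[n.+1]}) : muni p = 0 -> p = 0.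
Proof.
move=> p0; apply/mpolyP => m; rewrite mcoeff0.
have := coef_muni p (m ord_max) m; rewrite p0 coef0 mcoeff0.
have [mp|/memN_msupp_eq0 //] := boolP (m \in msupp p).
rewrite big_mkcond (bigD1_seq m) ?msupp_uniq //= !eqxx /= big1_seq ?addr0 // => m'.
case/andP=> /eqP ne _; case: ifP => // /andP[/eqP e1 /eqP/mnmP e2]; case: ne.
apply/mnmP => i; have [lt_in|le] := ltnP i n.
  have := e2 (Ordinal lt_in); rewrite !mnmE.
  by congr (_ = _); congr fun_of_multinom; apply: val_inj.
rewrite -(_ : ord_max = i) //; apply/val_inj/eqP.
by rewrite /= eqn_leq le -ltnS ltn_ord.
Qed.

Lemma meval_muni n (p : {mpoly F[n.+1]}) (v : 'I_n.+1 -> F) :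
  p.@[v] = (map_poly (meval (fun i => v (widen_ord (leqnSn n) i))) (muni p)).[v ord_max].
Proof.
rewrite muniE rmorph_sum /= horner_sum mevalE; apply: eq_bigr => m _.
rewrite map_polyZ /= map_polyXn hornerZ hornerXn mevalZ mevalX -mulrA.
rewrite big_ord_recr /=; congr (_ * (_ * _)).
by apply: eq_bigr => i _; rewrite mnmE.
Qed.

(** Induction on the number of variables: with the first ones fixed, the polynomial in the last
    variable is zero, so each of its coefficients vanishes at every point. *)
Lemma mpoly_vanish n (p : {mpoly F[n]}) : (forall v, p.@[v] = 0) -> p = 0.
Proof.
elim: n p => [|n IHn] p p0.
  have := p0 (fun=> 0); rewrite mevalE => e; apply/mpolyP => m.
  have m0 (m' : 'X_{1..0}) : m' = 0%MM by apply/mnmP => -[].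
  rewrite mcoeff0 [m]m0 -[RHS]e.
  have [|/memN_msupp_eq0 z] := boolP (0%MM \in msupp p); last first.
    by rewrite z big1 // => m' _; rewrite [m']m0 z mul0r.
  move=> mp; rewrite (bigD1_seq 0%MM) ?msupp_uniq //= big_ord0 mulr1 big1 ?addr0 //.
  by move=> m' /eqP[]; rewrite [m']m0.
apply: muni_inj0; apply/polyP => k; rewrite coef0; apply: IHn => v.
have : map_poly (meval v) (muni p) = 0.
  apply: poly_vanish => x.
  pose w (i : 'I_n.+1) := if unlift ord_max i is Some j then v j else x.
  have := meval_muni p w; rewrite p0 => ->; rewrite /w unlift_none.
  congr (horner _ _); apply: eq_map_poly => q; apply: meval_eq => i.
  suff -> : widen_ord (leqnSn n) i = lift ord_max i by rewrite liftK.
  by apply: val_inj; rewrite /= /bump leqNgt ltn_ord.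
by move/(congr1 (fun q : {poly F} => q`_k)); rewrite coef_map coef0.
Qed.

Lemma mpoly_ext n (p q : {mpoly F[n]}) : (forall v, p.@[v] = q.@[v]) -> p = q.
Proof.
move=> pq; apply/eqP; rewrite -subr_eq0; apply/eqP/mpoly_vanish => v.
by rewrite mevalB pq subrr.
Qed.

Lemma mpoly_nonvanish n (p : {mpoly F[n]}) : p != 0 -> ~ (forall v, p.@[v] == 0).
Proof. by move=> /eqP pn0 h; apply: pn0; apply: mpoly_vanish => v; apply/eqP. Qed.

End VanishingPolynomials.

(** * Nilpotent matrices and their exponentials *)

Section Nilpotent.
Variables (F : fieldType) (charF0 : [pchar F] =i pred0) (N : nat).
Implicit Types A B H : 'M[F]_N.

(* The powers [A^k] are eigenvectors of [ad H] for the pairwise distinct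
   eigenvalues [k c]. *)
Lemma ad_eigen_nilpotent H A c : c != 0 ->
  H *m A - A *m H = c *: A -> exists k, A ^+ k = 0.
Proof.
move=> c0 HA.
have HAk k : H *m (A ^+ k) - (A ^+ k) *m H = (k%:R * c) *: A ^+ k.
  elim: k => [|k IHk]; first by rewrite expr0 mulmx1 mul1mx subrr mul0r scale0r.
  rewrite exprS -[A * _]/(A *m _).
  rewrite (_ : _ - _ = (H *m A - A *m H) *m A ^+ k
                       + A *m (H *m A ^+ k - A ^+ k *m H)).
    by rewrite HA IHk -scalemxAl -scalemxAr -scalerDl -{1}(mul1r c) -mulrDl -natr1 addrC.
  by rewrite mulmxBl mulmxBr !mulmxA addrA subrK.
have [/existsP[k /eqP Ak]|] := boolP [exists k : 'I_(N * N).+1, A ^+ k == 0].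
  by exists k.
rewrite negb_exists => /forallP An0.
(* [M] is ad [H] on vectorised matrices. Its characteristic polynomial has degree [N * N], one less
   than the number of eigenvalues listed in [rs]. *)
pose M := lin_mx (mulmx H) - lin_mx (mulmxr H).
pose rs := [seq k%:R * c | k <- iota 0 (N * N).+1].
have Mn0 : char_poly M != 0 by rewrite monic_neq0 // char_poly_monic.
suff [h1 h2] : all (root (char_poly M)) rs /\ uniq rs.
  have := max_poly_roots Mn0 h1 h2; by rewrite size_map size_iota size_char_poly ltnn.
split.
  apply/allP => x /mapP[k]; rewrite mem_iota => /andP[_ ltk] ->.
  rewrite -eigenvalue_root_char; apply/eigenvalueP; exists (mxvec (A ^+ k)).
    by rewrite /M mulmxBr !mul_vec_lin /= -linearB /= HAk linearZ.
  by rewrite -(linear0 (@mxvec F N N)) (inj_eq (can_inj mxvecK)) (An0 (Ordinal ltk)).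
rewrite map_inj_uniq ?iota_uniq // => i j /(mulIf c0).
exact: natr_pchar0_inj.
Qed.

(** The inverse is the geometric series, which is finite here. *)
Lemma subr_nilpotent_unit (x : 'M[F]_N) k : x ^+ k = 0 -> 1%:M - x \in unitmx.
Proof.
move=> xk; have := subrX1 x k; rewrite xk sub0r => e.
have : (1%:M - x) *m (\sum_(i < k) x ^+ i) = 1%:M.
  by rewrite -opprB mulNmx; apply: oppr_inj; rewrite opprK; exact: esym e.
by case/mulmx1_unit.
Qed.

Section Exponential.
Variable (A : 'M[F]_N).

(** The term of degree [k] in the exponential series of [A]. *)
Let e k : 'M[F]_N := (k`!%:R)^-1 *: A ^+ k.

Let eS k : A *m e k = k.+1%:R *: e k.+1.
Proof.
rewrite /e -scalemxAr scalerA exprS factS natrM invfM mulrA mulfV ?natS_neq0 //.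
by rewrite mul1r.
Qed.

Let e2 := (2%:R : F)^-1.

(** Here [C] is the bracket of [A] with [B], [D] that of [A] with [C], and the next bracket is zero.
    So the series of exp(ad [A]) applied to [B] stops at [B + C + D / 2], and this is its degree by
    degree form. *)
Let exp_comm (B C D : 'M[F]_N) k : A *m B = B *m A + C -> A *m C = C *m A + D ->
  A *m D = D *m A ->
  [/\ e 0 *m B = B *m e 0, e 1 *m B = B *m e 1 + C *m e 0 &
  e k.+2 *m B = B *m e k.+2 + C *m e k.+1 + e2 *: (D *m e k)].
Proof.
move=> AB AC AD.
have e0 : e 0%N = 1%:M by rewrite /e expr0 invr1 scale1r.
have e1 : e 1%N = A by rewrite /e expr1 invr1 scale1r.
have comm j : e j *m A = A *m e j.
  rewrite /e -scalemxAl -scalemxAr; congr (_ *: _).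
  by rewrite -[_ *m _]/(_ * _) -[A *m _]/(_ * _) -exprSr exprS.
split; rewrite ?e1 ?e0 ?mulmx1 ?mul1mx //.
have e22 : e2 + e2 = 1 by rewrite -mulr2n -mulr_natl mulfV // natS_neq0.
elim: k => [|k IHk].
  have e2E : e 2 = e2 *: (A *m A) by rewrite /e expr2.
  rewrite e2E e1 e0 mulmx1 -scalemxAl -mulmxA AB mulmxDr mulmxA AB AC mulmxDl.
  rewrite -[B *m A *m A]mulmxA -scalemxAr -!addrA !scalerDr; congr (_ + _).
  by rewrite addrA -scalerDl e22 scale1r.
have k3 : k.+3%:R != 0 :> F by apply: natS_neq0.
(* After scaling by [k.+3], the term [e k.+3] becomes [A *m e k.+2], to which the induction
   hypothesis applies. *)
apply: (scalerI k3); rewrite scalemxAl -eS -mulmxA IHk !mulmxDr !mulmxA AB AC mulmxDl.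
have -> : A *m (e2 *: (D *m e k)) = (e2 * k.+1%:R) *: (D *m e k.+1).
  by rewrite -scalemxAr mulmxA AD -mulmxA eS -scalemxAr scalerA.
have -> : B *m A *m e k.+2 = k.+3%:R *: (B *m e k.+3).
  by rewrite -mulmxA eS scalemxAr.
have -> : (C *m A + D) *m e k.+1 = k.+2%:R *: (C *m e k.+2) + D *m e k.+1.
  by rewrite mulmxDl -mulmxA eS scalemxAr.
rewrite !scalerDr -!addrA; congr (_ + _).
rewrite addrA -{1}[C *m _]scale1r -scalerDl nat1r; congr (_ + _).
rewrite scalerA -{1}[D *m _]scale1r -scalerDl; congr (_ *: _).
by rewrite -[k.+3]addn2 natrD mulrDl [2%:R * _]mulr_natl mulr2n e22 addrC mulrC.
Qed.

(* [g] is the exponential of [A]. *)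
Lemma exp_conj K : A ^+ K = 0 -> exists2 g : 'M[F]_N, g \in unitmx &
  forall B C D : 'M[F]_N, A *m B = B *m A + C -> A *m C = C *m A + D ->
  A *m D = D *m A -> g *m B = (B + C + (2%:R : F)^-1 *: D) *m g.
Proof.
move=> AK; pose S m := \sum_(k < m) e k; exists (S K.+1).
  (* The exponential is [1 - A h] with [h] a polynomial in [A]; hence [A h] is nilpotent and the
     exponential is invertible. *)
  pose h := - \sum_(k < K) (k.+1`!%:R)^-1 *: A ^+ k : 'M[F]_N.
  have -> : S K.+1 = 1%:M - (A *m h).
    rewrite /S big_ord_recl /= mulmxN opprK; congr (_ + _).
      by rewrite /e expr0 invr1 scale1r.
    rewrite mulmx_sumr; apply: eq_bigr => i _; rewrite /e -scalemxAr exprS.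
    by rewrite -[A * _]/(A *m _).
  apply: (subr_nilpotent_unit (k := K)).
  have cAh : GRing.comm A h.
    apply: commrN; apply: commr_sum => k _.
    change (A *m (k.+1`!%:R^-1 *: A ^+ k) = (k.+1`!%:R^-1 *: A ^+ k) *m A).
    by rewrite -scalemxAr -scalemxAl; congr (_ *: _); apply: (commrX k).
  by rewrite -[A *m h]/(A * h) exprMn_comm // AK mul0r.
move=> B C D AB AC AD.
have eK k : (K <= k)%N -> e k = 0.
  by move=> leKk; rewrite /e -(subnK leKk) exprD AK mulr0 scaler0.
(* All terms from degree [K] on are zero, so longer partial sums are the same matrix. This lets the
   first one or two terms be split off while the tail keeps [K.+1] terms. *)
have SK j : S (K.+1 + j)%N = S K.+1.
  rewrite /S; elim: j => [|j IHj]; first by rewrite addn0.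
  by rewrite addnS big_ord_recr /= IHj eK ?addr0 // addSn ltnW // ltnS leq_addr.
have S1 : S K.+1 = e 0 + \sum_(k < K.+1) e k.+1.
  by rewrite -(SK 1) addn1 /S big_ord_recl.
have S2 : S K.+1 = e 0 + (e 1 + \sum_(k < K.+1) e k.+2).
  by rewrite -(SK 2) addn2 /S !big_ord_recl.
have [eB0 eB1 _] := exp_comm 0 AB AC AD.
have eB : (\sum_(k < K.+1) e k.+2) *m B = B *m (\sum_(k < K.+1) e k.+2) +
    C *m (\sum_(k < K.+1) e k.+1) + e2 *: (D *m S K.+1).
  rewrite !mulmx_sumr scaler_sumr mulmx_suml -!big_split /=.
  by apply: eq_bigr => k _; case: (exp_comm k AB AC AD).
rewrite {1}S2 !mulmxDl eB0 eB1 eB.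
rewrite -[in RHS]scalemxAl {2}S2 {2}S1 !mulmxDr !addrA; congr (_ + _ + _).
by rewrite -!addrA; do 2!congr (_ + _); rewrite addrC.
Qed.

End Exponential.
End Nilpotent.

(** * Transvections and Gaussian elimination *)

Section Transvections.
Variables (F : fieldType) (n : nat).
Implicit Types (v : 'cV[F]_n).

Definition transv (v : 'cV[F]_n) (k : 'I_n) : 'M[F]_n := 1%:M + v *m delta_mx 0 k.

Lemma mul_cV_delta (v : 'cV[F]_n) (k i j : 'I_n) :
  (v *m delta_mx 0 k) i j = v i 0 *+ (j == k).
Proof. by rewrite mxE big_ord1 mxE eqxx /= mulr_natr. Qed.

Lemma transv_sq0 (v : 'cV[F]_n) k : v k 0 = 0 ->
  (v *m delta_mx 0 k) *m (v *m delta_mx 0 k) = 0 :> 'M[F]_n.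
Proof.
move=> vk; rewrite mulmxA -[v *m _ *m v]mulmxA (_ : delta_mx 0 k *m v = 0) ?mulmx0 ?mul0mx //.
by apply/matrixP => i j; rewrite !ord1 -rowE !mxE vk.
Qed.

Lemma transv_mulN (v : 'cV[F]_n) k : v k 0 = 0 -> transv v k *m transv (- v) k = 1%:M.
Proof.
move=> vk; rewrite /transv mulNmx mulmxDl mul1mx mulmxDr mulmxN mulmx1.
by rewrite transv_sq0 // oppr0 addr0 subrK.
Qed.

Lemma transv_mulE v k (A : 'M[F]_n) i j : (transv v k *m A) i j = A i j + v i 0 * A k j.
Proof. by rewrite mulmxDl mul1mx -mulmxA -rowE !mxE big_ord1 !mxE. Qed.

(** The invariant of elimination when columns are cleared from left to right. *)
Definition diag_upto (k : nat) (A : 'M[F]_n) :=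
  forall i j : 'I_n, (j < k)%N -> i != j -> A i j = 0.

(** Without a pivot, column [k] would be a combination of the earlier columns, which are nonzero
    multiples of basis vectors; this contradicts invertibility. *)
Lemma diag_upto_pivot (k : 'I_n) (A : 'M[F]_n) : A \in unitmx -> diag_upto k A ->
  exists2 i : 'I_n, (k <= i)%N & A i k != 0.
Proof.
move=> uA dA; have Ainj (x : 'cV_n) : A *m x = 0 -> x = 0.
  by move=> Ax; rewrite -[x](mulKmx uA) Ax mulmx0.
have Ajj (j : 'I_n) : (j < k)%N -> A j j != 0.
  move=> ltjk; apply/eqP => Ajj; have : delta_mx j 0 = 0 :> 'cV[F]_n.
    apply: Ainj; rewrite -colE; apply/colP => i; rewrite !mxE.
    by have [->//|ne] := eqVneq i j; rewrite dA.
  by move/matrixP/(_ j 0)/eqP; rewrite !mxE !eqxx oner_eq0.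
have [/existsP[i /andP[lei Aik]]|] := boolP [exists i : 'I_n, (k <= i)%N && (A i k != 0)].
  by exists i.
rewrite negb_exists => /forallP nA.
(* The coefficients of that linear dependence, as an explicit kernel vector. *)
pose x : 'cV[F]_n := \col_j (if j == k then 1 else if (j < k)%N then - (A j k / A j j) else 0).
have : x = 0.
  apply: Ainj; apply/colP => i; rewrite !mxE (bigD1 k) //= mxE eqxx mulr1.
  have [ltik|leki] := ltnP i k; last first.
    have := nA i; rewrite leki /= negbK => /eqP ->; rewrite add0r big1 // => j nejk.
    rewrite mxE (negPf nejk); case: ifP => ltjk; last by rewrite mulr0.
    by rewrite dA ?mul0r //; apply: contraTneq leki => ->; rewrite -ltnNge.
  have neik : i != k by apply: contraTneq ltik => ->; rewrite ltnn.
  rewrite (bigD1 i) //= mxE (negPf neik) ltik mulrN mulrCA mulfV ?Ajj // mulr1 addrA subrr add0r.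
  rewrite big1 // => j /andP[nejk neji]; rewrite mxE (negPf nejk).
  by case: ifP => ltjk; rewrite ?mulr0 // dA ?mul0r // eq_sym.
by move/matrixP/(_ k 0)/eqP; rewrite !mxE eqxx oner_eq0.
Qed.

(** Elimination by row additions only, without row exchanges. The predicate [K] stands for any
    property that passes from transvections to their products. *)
Lemma unitmx_transvections (K : 'M[F]_n -> Prop) : K 1%:M ->
    (forall A B, K A -> K B -> K (A *m B)) ->
    (forall v k, v k 0 = 0 -> K (transv v k)) ->
  forall P, P \in unitmx -> exists T d, [/\ K T, T \in unitmx & P = T *m diag_mx d].
Proof.
move=> K1 KM Kt P uP.
have step : forall k, (k <= n)%N -> exists T Q, [/\ K T, T \in unitmx, P = T *m Q & diag_upto k Q].
  elim=> [_|k IHk ltkn].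
    by exists 1%:M, P; split; rewrite ?unitmx1 ?mul1mx // => i j; rewrite ltn0.
  have [T [Q [KT uT PTQ dQ]]] := IHk (ltnW ltkn).
  pose k' := Ordinal ltkn.
  have unitQ : Q \in unitmx by move: uP; rewrite PTQ unitmx_mul => /andP[].
  have [T1 [Q1 [KT1 uT1 PT1 dQ1 Q1k]]] : exists T1 Q1, [/\ K T1, T1 \in unitmx,
      P = T1 *m Q1, diag_upto k Q1 & Q1 k' k' != 0].
    have [i leki Qik] := @diag_upto_pivot k' Q unitQ dQ.
    have [Qkk|Qkk] := eqVneq (Q k' k') 0; last by exists T, Q.
    have neki : k' != i by apply: contraNneq Qik => <-; rewrite Qkk.
    have vi : (delta_mx k' 0 : 'cV[F]_n) i 0 = 0 by rewrite mxE eq_sym (negPf neki).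
    (* A zero pivot is repaired by adding row [i] to row [k']. Row [i] is zero in the earlier
       columns, so these stay diagonal. *)
    exists (T *m transv (- delta_mx k' 0) i), (transv (delta_mx k' 0) i *m Q).
    have tt := transv_mulN vi.
    have [ut1 ut2] := mulmx1_unit tt.
    split.
    - by apply: KM => //; apply: Kt; rewrite mxE vi oppr0.
    - by rewrite unitmx_mul uT.
    - by rewrite -mulmxA [X in T *m X]mulmxA (mulmx1C tt) mul1mx.
    - move=> a b ltbk neab; rewrite transv_mulE dQ // add0r dQ ?mulr0 //.
      by apply: contraTneq ltbk => <-; rewrite -leqNgt.
    - by rewrite transv_mulE Qkk add0r mxE !eqxx mul1r.
  (* The multiples of the pivot row that clear the rest of column [k']. *)
  pose v : 'cV[F]_n := \col_i (if i == k' then 0 else - (Q1 i k' / Q1 k' k')).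
  have vk : v k' 0 = 0 by rewrite mxE eqxx.
  have tt := transv_mulN vk.
  have [ut1 ut2] := mulmx1_unit tt.
  exists (T1 *m transv (- v) k'), (transv v k' *m Q1); split.
  - by apply: KM => //; apply: Kt; rewrite mxE vk oppr0.
  - by rewrite unitmx_mul uT1.
  - by rewrite -mulmxA [X in T1 *m X]mulmxA (mulmx1C tt) mul1mx.
  - move=> a b; rewrite ltnS leq_eqVlt => /orP[/eqP eb|ltbk] neab; rewrite transv_mulE.
      have -> : b = k' by apply: val_inj.
      rewrite mxE (_ : (a == k') = false); last first.
        by apply: contraNF neab => /eqP ->; apply/eqP/val_inj.
      by rewrite mulNr divfK ?subrr.
    rewrite dQ1 // add0r dQ1 ?mulr0 //.
    by apply: contraTneq ltbk => <-; rewrite /= ltnn.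
have [T [Q [KT uT PTQ dQ]]] := step n (leqnn n).
exists T, (\row_i Q i i); split; rewrite // PTQ; congr (_ *m _).
apply/matrixP => i j; rewrite !mxE; case: eqVneq => [->|ne]; first by rewrite mulr1n.
by rewrite mulr0n dQ.
Qed.

Lemma invmxM (A B : 'M[F]_n) : A \in unitmx -> B \in unitmx ->
  invmx (A *m B) = invmx B *m invmx A.
Proof.
move=> uA uB; have uAB : A *m B \in unitmx by rewrite unitmx_mul uA.
apply: (can_inj (mulKmx uAB)); rewrite mulmxV //.
by rewrite -mulmxA [X in A *m X]mulmxA mulmxV // mul1mx mulmxV.
Qed.

(* The diagonal factor of [P] disappears because it commutes with [diag_mx d]. *)
Lemma conj_diag_transvections (K : 'M[F]_n -> Prop) : K 1%:M ->
    (forall A B, A \in unitmx -> B \in unitmx -> K A -> K B -> K (A *m B)) ->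
    (forall v k, v k 0 = 0 -> K (transv v k)) ->
  forall P, P \in unitmx -> exists2 T, K T &
    forall d, T *m diag_mx d *m invmx T = P *m diag_mx d *m invmx P.
Proof.
move=> K1 KM Kt P uP; pose K' T := T \in unitmx /\ K T.
have [|||T [d [[_ KT] uT eP]]] := @unitmx_transvections K' _ _ _ P uP.
- by split; rewrite ?unitmx1.
- by move=> A B [uA KA] [uB KB]; split; [rewrite unitmx_mul uA|apply: KM].
- move=> v k vk; split; last exact: Kt.
  by have [] := mulmx1_unit (transv_mulN vk).
exists T => // d'; apply: (can_inj (mulmxK uP)); rewrite [RHS]mulmxKV //.
by rewrite eP !mulmxA mulmxKV // -!mulmxA diag_mxC.
Qed.

End Transvections.

(** * Lifting conjugations through a representation of sl(n) *)

Section Representation.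
Variables (F : fieldType) (charF0 : [pchar F] =i pred0) (n N : nat).
Variables (phi : 'M[F]_n -> 'M[F]_N) (Hrep : is_lie_rep phi).

Lemma in_slP (X : 'M[F]_n) : reflect (\tr X = 0) (in_sl X).
Proof. exact: eqP. Qed.

Lemma in_sl0 : in_sl (0 : 'M[F]_n).
Proof. by apply/in_slP; rewrite linear0. Qed.

Lemma in_slD (X Y : 'M[F]_n) : in_sl X -> in_sl Y -> in_sl (X + Y).
Proof. by move=> /in_slP X0 /in_slP Y0; apply/in_slP; rewrite linearD /= X0 Y0 addr0. Qed.

Lemma in_slZ a (X : 'M[F]_n) : in_sl X -> in_sl (a *: X).
Proof. by move=> /in_slP X0; apply/in_slP; rewrite linearZ /= X0 mulr0. Qed.

Lemma in_sl_comm (X Y : 'M[F]_n) : in_sl (X *m Y - Y *m X).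
Proof. by apply/in_slP; rewrite linearB /= mxtrace_mulC subrr. Qed.

Lemma in_sl_diag (d : 'rV[F]_n) : in_sl (diag_mx d) = (\sum_i d 0 i == 0).
Proof. by rewrite /in_sl mxtrace_diag. Qed.

Lemma in_sl_sum (I : Type) (r : seq I) (P : pred I) (X : I -> 'M[F]_n) :
  (forall i, P i -> in_sl (X i)) -> in_sl (\sum_(i <- r | P i) X i).
Proof.
by move=> h; apply: (big_ind (@in_sl F n)); [exact: in_sl0|exact: in_slD|].
Qed.

Lemma delta_sl (i j : 'I_n) : i != j -> in_sl (delta_mx i j : 'M[F]_n).
Proof.
move=> ne; apply/in_slP; rewrite /mxtrace big1 // => k _; rewrite mxE.
by case: eqP => [->|] //=; rewrite (negPf ne).
Qed.

Lemma diag_delta_comm (d : 'rV[F]_n) (i j : 'I_n) :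
  diag_mx d *m delta_mx i j - delta_mx i j *m diag_mx d = (d 0 i - d 0 j) *: delta_mx i j.
Proof.
rewrite mul_diag_mx mul_mx_diag; apply/matrixP => a b; rewrite !mxE.
case: (a =P i) => [->|_]; case: (b =P j) => [->|_] /=; rewrite ?mulr0 ?mul0r ?subrr ?mulr1 //.
by rewrite mul1r.
Qed.

Lemma sl_decomp (X : 'M[F]_n) :
  X = \sum_i \sum_(j | j != i) X i j *: delta_mx i j + diag_mx (\row_i X i i).
Proof.
rewrite {1}[X]matrix_sum_delta; have -> : diag_mx (\row_i X i i) = \sum_i X i i *: delta_mx i i.
  by rewrite diag_mx_sum_delta; apply: eq_bigr => i _; rewrite mxE.
rewrite -big_split /=; apply: eq_bigr => i _.
by rewrite (bigD1 i) //= addrC.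
Qed.

Lemma phi0 : phi 0 = 0.
Proof.
have := Hrep.1 1 _ _ in_sl0 in_sl0; rewrite !scale1r addr0 => /esym/eqP.
by rewrite -subr_eq0 addrK => /eqP.
Qed.

Lemma phiZ a X : in_sl X -> phi (a *: X) = a *: phi X.
Proof. by move=> sX; have := Hrep.1 a _ _ sX in_sl0; rewrite !addr0 phi0 addr0. Qed.

Lemma phiD X Y : in_sl X -> in_sl Y -> phi (X + Y) = phi X + phi Y.
Proof. by move=> sX sY; have := Hrep.1 1 _ _ sX sY; rewrite !scale1r. Qed.

Lemma phi_sum (I : Type) (r : seq I) (P : pred I) (X : I -> 'M[F]_n) :
  (forall i, P i -> in_sl (X i)) ->
  phi (\sum_(i <- r | P i) X i) = \sum_(i <- r | P i) phi (X i).
Proof.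
move=> h; elim: r => [|i r IHr]; first by rewrite !big_nil phi0.
rewrite !big_cons; case: ifP => // Pi; rewrite phiD ?IHr ?h //; exact: in_sl_sum.
Qed.

Lemma phi_mulC X Y : in_sl X -> in_sl Y ->
  phi X *m phi Y = phi Y *m phi X + phi (X *m Y - Y *m X).
Proof. by move=> sX sY; rewrite Hrep.2 // addrC subrK. Qed.

Lemma phi_nilpotent H E c : in_sl H -> in_sl E -> c != 0 ->
  H *m E - E *m H = c *: E -> exists k, phi E ^+ k = 0.
Proof.
move=> sH sE c0 HE; apply: (ad_eigen_nilpotent charF0 (H := phi H) c0).
by rewrite -Hrep.2 // HE phiZ.
Qed.

(** Only the Lie algebra acts on V. The matrix [g] plays the role of the action of the group element
    [T], and the property is stable under products of invertible [T]. *)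
Definition intertwined (T : 'M[F]_n) := exists2 g : 'M[F]_N, g \in unitmx &
  forall X, in_sl X -> g *m phi X = phi (T *m X *m invmx T) *m g.

Lemma in_sl_conj (T X : 'M[F]_n) : T \in unitmx -> in_sl X -> in_sl (T *m X *m invmx T).
Proof. by move=> uT /in_slP sX; apply/in_slP; rewrite mxtrace_mulC mulmxA mulVmx // mul1mx. Qed.

(** As [E] squares to zero, [D = - 2 E X E] commutes with [E], and conjugation by [1 + E] is exp(ad
    [E]) cut after second order. *)
Lemma conj_sq0 (E X : 'M[F]_n) (C := E *m X - X *m E) (D := E *m C - C *m E) :
  E *m E = 0 ->
  E *m D - D *m E = 0 /\ (1%:M + E) *m X *m (1%:M - E) = X + C + 2%:R^-1 *: D.
Proof.
move=> EE; have DE : D = - 2%:R *: (E *m X *m E).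
  rewrite /D /C mulmxBr mulmxBl !mulmxA EE mul0mx sub0r -[X *m E *m E]mulmxA EE mulmx0 subr0.
  by rewrite scaleNr scaler_nat mulr2n opprD.
split.
  rewrite DE -scalemxAl -scalemxAr !mulmxA EE !mul0mx -mulmxA EE mulmx0.
  by rewrite scaler0 subrr.
have e2 : 2%:R^-1 * - 2%:R = -1 :> F.
  by rewrite mulrN; congr (- _); exact: mulVf (natS_neq0 charF0 1).
rewrite DE scalerA e2 scaleN1r.
rewrite !mulmxDl !mulmxBr mul1mx !mulmx1 /C !addrA; congr (_ - _).
by rewrite -!addrA; congr (_ + _); rewrite addrC.
Qed.

(** The intertwiner is the exponential of [phi E]: conjugating by it on V and by [1 + E] on matrices
    gives the same expansion [X + C + D / 2]. *)
Lemma transv_intertwined (v : 'cV[F]_n) k : v k 0 = 0 -> intertwined (transv v k).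
Proof.
move=> vk; set E := v *m delta_mx 0 k : 'M[F]_n.
have EE : E *m E = 0 by apply: transv_sq0.
have n0 : n%:R != 0 :> F by rewrite ((pcharf0P F).1 charF0) -lt0n (leq_ltn_trans _ (ltn_ord k)).
have sE : in_sl E.
  apply/in_slP; rewrite /mxtrace big1 // => i _; rewrite mul_cV_delta.
  by case: eqP => [->|_]; rewrite ?vk ?mulr0n.
(* The traceless part of [delta_mx k k]. Since [v k 0 = 0], its bracket with [E] is [- E], which
   makes [phi E] nilpotent. *)
pose H : 'M[F]_n := delta_mx k k - n%:R^-1 %:M.
have sH : in_sl H.
  apply/in_slP; rewrite linearB /= mxtrace_scalar -[_ *+ n]mulr_natl mulfV //.
  rewrite /mxtrace (bigD1 k) //= mxE eqxx big1 ?addr0 ?subrr // => i /negPf nik.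
  by rewrite mxE nik.
have [K EK] : exists K, phi E ^+ K = 0.
  apply: (@phi_nilpotent H E (-1)) => //; first by rewrite oppr_eq0 oner_eq0.
  rewrite /H mulmxBl mulmxBr scalar_mxC opprD opprK addrACA addNr addr0.
  rewrite /E -mulmxA mul_delta_mx mulmxA (_ : delta_mx k k *m v = 0) ?mul0mx ?sub0r ?scaleN1r //.
  apply/colP => i; rewrite !mxE big1 // => j _; rewrite mxE.
  by case: (j =P k) => [->|_]; rewrite ?vk ?mulr0 // andbF mul0r.
have [g ug gP] := exp_conj charF0 EK; exists g => // X sX.
have iT : invmx (transv v k) = 1%:M - E.
  have tt := transv_mulN vk; have [u1 _] := mulmx1_unit tt.
  have -> : 1%:M - E = transv (- v) k by rewrite /transv mulNmx.
  by apply: (can_inj (mulKmx u1)); rewrite mulmxV ?tt.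
pose C := E *m X - X *m E; pose D := E *m C - C *m E.
have sC : in_sl C by apply: in_sl_comm.
have sD : in_sl D by apply: in_sl_comm.
have [ED TXT] := conj_sq0 X EE.
have hX : phi E *m phi X = phi X *m phi E + phi C := phi_mulC sE sX.
have hC : phi E *m phi C = phi C *m phi E + phi D := phi_mulC sE sC.
have hD : phi E *m phi D = phi D *m phi E by rewrite (phi_mulC sE sD) ED phi0 addr0.
rewrite (gP _ _ _ hX hC hD) iT TXT; congr (_ *m _).
by rewrite (phiD (in_slD sX sC) (in_slZ _ sD)) (phiD sX sC) (phiZ _ sD).
Qed.

(** The restriction to diagonal matrices makes the diagonal factor of [P] harmless, so that only
    transvections have to be lifted. *)
Lemma intertwined_diag P : P \in unitmx -> exists2 g : 'M[F]_N, g \in unitmx &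
  forall d : 'rV[F]_n, \sum_i d 0 i = 0 ->
    g *m phi (diag_mx d) = phi (P *m diag_mx d *m invmx P) *m g.
Proof.
move=> uP; have [|||T [g ug gP] TP] := @conj_diag_transvections F n intertwined _ _ _ P uP.
- by exists 1%:M => [|X sX]; rewrite ?unitmx1 // !mul1mx invmx1 !mulmx1.
- move=> A B uA uB [g ug gA] [h uh hB].
  exists (g *m h) => [|X sX]; first by rewrite unitmx_mul ug.
  rewrite -mulmxA hB // mulmxA gA ?in_sl_conj // -!mulmxA; congr (phi _ *m _).
  by rewrite invmxM // !mulmxA.
- by move=> v k vk; apply: transv_intertwined.
by exists g => // d sd; rewrite gP ?in_sl_diag ?sd // TP.
Qed.

End Representation.

(** * Integrality of eigenvalues for sl(2) triples *)

Section Sl2.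
Variables (F : fieldType) (charF0 : [pchar F] =i pred0) (N : nat).
Implicit Types (e f h x : 'M[F]_N) (v u : 'cV[F]_N).

Lemma nilpotent_last x v K : x ^+ K = 0 -> v != 0 ->
  exists2 m, x ^+ m *m v != 0 & x ^+ m.+1 *m v = 0.
Proof.
move=> xK v0; have ex : exists m, x ^+ m *m v == 0 by exists K; rewrite xK mul0mx.
case: (ex_minnP ex) => -[|m] /eqP xm min; first by rewrite expr0 mul1mx in xm; case/eqP: v0.
by exists m => //; apply/negP => /min; rewrite ltnn.
Qed.

(** Powers of [e] raise [v] to a highest weight vector [u] of eigenvalue [b]; powers of [f] then
    lower [u] until it dies. The identity [ef_u] at the last nonzero vector forces [b] to be a
    natural, and [a] differs from [b] by an even natural. *)
Lemma sl2_eigenvalue_int e f h K K' v a :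
    h *m e - e *m h = 2%:R *: e -> h *m f - f *m h = - 2%:R *: f ->
    e *m f - f *m e = h -> e ^+ K = 0 -> f ^+ K' = 0 ->
    v != 0 -> h *m v = a *: v ->
  exists k l : nat, a = k%:R - l%:R.
Proof.
move=> he hf ef eK fK v0 hv.
have shift x c (b : F) u m : h *m x - x *m h = c *: x -> h *m u = b *: u ->
    h *m (x ^+ m *m u) = (b + m%:R * c) *: (x ^+ m *m u).
  move=> hx hu; elim: m => [|m IHm]; first by rewrite expr0 mul1mx mul0r addr0.
  rewrite exprS -[x * _]/(x *m _) -mulmxA mulmxA -[h *m x](subrK (x *m h)) hx mulmxDl.
  rewrite -mulmxA IHm -scalemxAl -scalemxAr -scalerDl; congr (_ *: _).
  by rewrite -natr1; ring.
have [m u0 eu] := nilpotent_last eK v0.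
set u := e ^+ m *m v in u0; set b := a + m%:R * 2%:R.
have hu : h *m u = b *: u by apply: shift.
have {}eu : e *m u = 0 by rewrite /u mulmxA -[e *m _]/(e * _) -exprS.
have ef_u k : e *m (f ^+ k.+1 *m u) = (k.+1%:R * (b - k%:R)) *: (f ^+ k *m u).
  elim: k => [|k IHk].
    rewrite expr0 expr1 mul1mx mulmxA -[e *m f](subrK (f *m e)) ef mulmxDl hu.
    by rewrite -mulmxA eu mulmx0 addr0 subr0 mul1r.
  rewrite exprS -[f * _]/(f *m _) -mulmxA mulmxA -[e *m f](subrK (f *m e)) ef mulmxDl.
  have ffu : f *m (f ^+ k *m u) = f ^+ k.+1 *m u.
    by rewrite mulmxA -[f *m _]/(f * _) -exprS.
  rewrite -mulmxA IHk (shift _ _ _ _ _ hf hu) -scalemxAr ffu.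
  rewrite -scalerDl; congr (_ *: _).
  by rewrite -!natr1; ring.
have [k fu0 fu] := nilpotent_last fK u0.
have := ef_u k; rewrite fu mulmx0 => /esym/eqP; rewrite scaler_eq0 (negPf fu0) orbF.
rewrite mulf_eq0 (negPf (natS_neq0 charF0 _)) /= subr_eq0 => /eqP bk.
by exists k, (m * 2)%N; rewrite -bk natrM addrK.
Qed.

End Sl2.

(** * Rank of a diagonal 0-1 matrix *)

Section RankDiag.
Variables (F : fieldType) (N : nat).

Lemma rank_diag_pred (S : pred 'I_N) : \rank (diag_mx (\row_a (S a)%:R) : 'M[F]_N) = #|S|.
Proof.
(* The rows of [R] are the basis vectors indexed by [S]; the diagonal matrix factors as
   [R^T *m R]. *)
pose R : 'M[F]_(#|S|, N) := \matrix_(i, j) (enum_val i == j)%:R.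
have RR : R *m R^T = 1%:M.
  apply/matrixP => i j; rewrite !mxE (bigD1 (enum_val i)) //= !mxE eqxx mul1r.
  rewrite big1 ?addr0 ?(inj_eq enum_val_inj) 1?eq_sym // => k ne.
  by rewrite !mxE eq_sym (negPf ne) mul0r.
have fR : row_free R by apply/row_freeP; exists R^T.
have -> : diag_mx (\row_a (S a)%:R) = R^T *m R.
  apply/matrixP => a b; rewrite !mxE; have [Sa|nSa] := boolP (S a); last first.
    rewrite mul0rn big1 // => i _; rewrite !mxE.
    by case: eqP => [e|]; rewrite ?mul0r //; case/negP: nSa; rewrite -e; apply: (enum_valP i).
  rewrite (bigD1 (enum_rank_in Sa a)) //= !mxE enum_rankK_in // eqxx mul1r big1 ?addr0 //.
  move=> i ne; rewrite !mxE; case: eqP => [e|]; rewrite ?mul0r //.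
  by case/eqP: ne; apply: enum_val_inj; rewrite enum_rankK_in // e.
by rewrite mxrankMfree // mxrank_tr; apply/eqP.
Qed.

End RankDiag.

(** * Weights in coordinates, the Weyl group action and dominance *)

Section Dot.
Variables (F : fieldType) (charF0 : [pchar F] =i pred0) (n : nat).
Implicit Types (w d : 'rV[F]_n).

Definition wdot w d := \sum_i w 0 i * d 0 i.

Lemma wval_diag w d : wval w (diag_mx d) = wdot w d.
Proof. by apply: eq_bigr => i _; rewrite mxE eqxx mulr1n. Qed.

Lemma Hmx_diag j : Hmx F n j = diag_mx (\row_a ((val a == j)%:R - (val a == j.+1)%:R)).
Proof.
apply/matrixP => a b; rewrite !mxE; case: eqP => _; by rewrite ?mulr1n ?mulr0n.
Qed.

Lemma wval_Hmx w (a b : 'I_n) : b = a.+1 :> nat -> wval w (Hmx F n a) = w 0 a - w 0 b.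
Proof.
move=> eb; have HE i : Hmx F n a i i = (i == a)%:R - (i == b)%:R.
  by rewrite /Hmx mxE eqxx -!val_eqE /= eb.
have /negPf nba : b != a by rewrite -val_eqE /= eb gtn_eqF.
rewrite /wval (bigD1 a) //= (bigD1 b) ?nba //= !HE !eqxx nba eq_sym nba.
rewrite subr0 mulr1 sub0r mulrN1 big1 ?addr0 // => i.
by case/andP => /negPf nia /negPf nib; rewrite HE nia nib subrr mulr0.
Qed.

Lemma Hmx_sl j : (j < n.-1)%N -> in_sl (Hmx F n j).
Proof.
move=> ltj; have ltjn : (j < n)%N by rewrite (leq_trans ltj) ?leq_pred.
have ltj1 : (j.+1 < n)%N by move: ltj; case: (n) => // m.
(* The trace is the pairing with the all-ones vector, whose coordinates have zero differences. *)
have := @wval_Hmx (const_mx 1) (Ordinal ltjn) (Ordinal ltj1) erefl.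
rewrite !mxE subrr => e; apply/in_slP; rewrite -[RHS]e.
by apply: eq_bigr => i _; rewrite [const_mx _ _ _]mxE mul1r.
Qed.

(** Values on the [Hmx] are differences of consecutive coordinates, so [w - w'] is constant. Its
    coordinates sum to 0 and [n] is invertible in [F], so the constant is 0. *)
Lemma weight_ext w w' : is_weight_rep w -> is_weight_rep w' ->
  (forall j, (j < n.-1)%N -> wval w (Hmx F n j) = wval w' (Hmx F n j)) -> w = w'.
Proof.
move=> /eqP sw /eqP sw' h; apply/rowP => i0.
have n0 : (0 < n)%N by apply: leq_ltn_trans (ltn_ord i0).
pose o := Ordinal n0.
have c0 (i : 'I_n) : w 0 i - w' 0 i = w 0 o - w' 0 o.
  case: i => i; elim: i => [|i IHi] lti; first by congr (w 0 _ - w' 0 _); apply: val_inj.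
  have lti' : (i < n)%N by apply: ltnW.
  have ltip : (i < n.-1)%N by move: lti; case: (n).
  rewrite -(IHi lti'); have := h i ltip.
  rewrite -[i]/(nat_of_ord (Ordinal lti')) !(@wval_Hmx _ (Ordinal lti') (Ordinal lti)) //.
  move/eqP; rewrite -subr_eq0 => /eqP e; apply/eqP; rewrite -subr_eq0; apply/eqP.
  by rewrite -[RHS]oppr0 -e; ring.
have : \sum_i (w 0 i - w' 0 i) = 0 by rewrite sumrB sw sw' subrr.
under eq_bigr => i _ do rewrite c0.
rewrite sumr_const card_ord -mulr_natl => /eqP; rewrite mulf_eq0 ((pcharf0P F).1 charF0).
rewrite -leqn0 leqNgt n0 /=.
by move=> /eqP z; apply/eqP; rewrite -subr_eq0 c0 z.
Qed.

Lemma wdot_act s w d : wdot (wact s w) (wact s d) = wdot w d.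
Proof.
rewrite /wdot [RHS](reindex_inj (@perm_inj _ s)) /=.
by apply: eq_bigr => i _; rewrite !mxE.
Qed.

Lemma sum_act s d : \sum_i (wact s d) 0 i = \sum_i d 0 i.
Proof.
rewrite [RHS](reindex_inj (@perm_inj _ s)) /=.
by apply: eq_bigr => i _; rewrite !mxE.
Qed.

Lemma wactM s t w : wact s (wact t w) = wact (s * t)%g w.
Proof. by apply/rowP => i; rewrite !mxE permM. Qed.

Lemma wact1 w : wact 1%g w = w.
Proof. by apply/rowP => i; rewrite !mxE perm1. Qed.

Lemma wactK s : cancel (wact s) (@wact F n s^-1%g).
Proof. by move=> w; rewrite wactM mulVg wact1. Qed.

Lemma wactKV s : cancel (@wact F n s^-1%g) (wact s).
Proof. by move=> w; rewrite wactM mulgV wact1. Qed.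

Lemma worbitP w w' : reflect (exists s, w' = wact s w) (w' \in worbit w).
Proof.
rewrite mem_undup; apply: (iffP mapP) => [[s _ ->]|[s ->]]; first by exists s.
by exists s; rewrite ?mem_enum.
Qed.

Lemma worbit_sum w w' : w' \in worbit w -> \sum_i w' 0 i = \sum_i w 0 i.
Proof. by case/worbitP => s ->; apply: sum_act. Qed.

Lemma perm_diag_conj s d :
  perm_mx s *m diag_mx d *m invmx (perm_mx s) = diag_mx (wact s d).
Proof.
have up := unitmx_perm F s.
apply: (can_inj (mulmxK up)); rewrite mulmxKV //.
apply/matrixP => i j; rewrite -row_permE !mxE (bigD1 i) //= !mxE eqxx mulr1n big1 ?addr0.
  by case: eqP => _; rewrite ?mulr1 ?mulr1n ?mulr0.
by move=> k ne; rewrite !mxE eq_sym (negPf ne) mulr0n mul0r.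
Qed.

(** Integers of [F] are written as differences of two naturals. *)
Definition integral_diff w := forall i j : 'I_n, exists k l : nat, w 0 i - w 0 j = k%:R - l%:R.

(** [F] has no order; passing to naturals up to a common shift makes sorting of coordinates
    possible. *)
Lemma integral_coords w : integral_diff w ->
  exists (c : F) (k : 'I_n -> nat), forall i, w 0 i = c + (k i)%:R.
Proof.
move=> hw; have [n0|n0] := posnP n.
  by exists 0, (fun=> 0%N) => i; have := ltn_ord i; rewrite [X in (_ < X)%N]n0.
pose o := Ordinal n0.
have [p pP] : exists p : 'I_n -> nat * nat, forall i, w 0 i - w 0 o = (p i).1%:R - (p i).2%:R.
  apply: (fin_all_exists (P := fun i p => w 0 i - w 0 o = p.1%:R - p.2%:R)) => i.
  by have [k [l e]] := hw i o; exists (k, l).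
(* [Q] bounds every negative part, so adding it turns all coordinates into naturals. *)
pose Q := (\sum_i (p i).2)%N.
exists (w 0 o - Q%:R), (fun i => ((p i).1 + (Q - (p i).2))%N) => i.
have le : ((p i).2 <= Q)%N by rewrite /Q (bigD1 i) //= leq_addr.
by rewrite natrD natrB // -[LHS](subrK (w 0 o)) pP; ring.
Qed.

Lemma geq_trans : transitive geq.
Proof. by move=> a b c ba ac; apply: leq_trans ac ba. Qed.

Lemma geq_anti : antisymmetric geq.
Proof. by move=> a b; rewrite /geq /= andbC -eqn_leq => /eqP. Qed.

Lemma dominant_sorted w c (k : 'I_n -> nat) : (forall i, w 0 i = c + (k i)%:R) ->
  dominant w <-> sorted geq [tuple k i | i < n].
Proof.
move=> wk; split=> [dw|].
  apply/(sortedP 0%N) => i; rewrite size_tuple => lti.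
  have lti0 := ltnW lti; have ltip : (i < n.-1)%N by move: lti; case: (n).
  have := dw i ltip; rewrite -[i]/(val (Ordinal lti0)) => -[a].
  rewrite (@wval_Hmx _ (Ordinal lti0) (Ordinal lti)) // !wk => e.
  rewrite -(tnth_nth _ _ (Ordinal lti0)) -(tnth_nth _ _ (Ordinal lti)) !tnth_mktuple.
  have : (k (Ordinal lti0))%:R = (k (Ordinal lti) + a)%:R :> F by rewrite natrD -e; ring.
  by move/(natr_pchar0_inj charF0) => /= ->; apply: leq_addr.
move=> /(sortedP 0%N); rewrite size_tuple => so j ltj.
have ltj1 : (j.+1 < n)%N by move: ltj; case: (n).
have ltj0 := ltnW ltj1; exists (k (Ordinal ltj0) - k (Ordinal ltj1))%N.
have := so _ ltj1.
rewrite -(tnth_nth _ _ (Ordinal ltj0)) -(tnth_nth _ _ (Ordinal ltj1)) !tnth_mktuple => le.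
rewrite natrB // -[j in Hmx F n j]/(val (Ordinal ltj0)).
rewrite (@wval_Hmx _ (Ordinal ltj0) (Ordinal ltj1)) // !wk.
by ring.
Qed.

(** A dominant weight is one with weakly decreasing coordinates, so sorting provides the
    permutation. *)
Lemma dominant_exists w : integral_diff w -> exists s, dominant (wact s w).
Proof.
case/integral_coords => c [k wk].
have /tuple_permP[s es] : perm_eq (sort geq [tuple k i | i < n]) [tuple k i | i < n].
  by rewrite perm_sort.
exists s; apply/(@dominant_sorted _ c (fun i => k (s i))) => [i|]; first by rewrite mxE.
have -> : [tuple k (s i) | i < n] = [tuple tnth [tuple k i | i < n] (s i) | i < n].
  by apply: eq_from_tnth => i; rewrite !tnth_mktuple.
by rewrite -es; apply: sort_sorted => a b; rewrite /geq /= leq_total.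
Qed.

(** Two sorted rearrangements of the same list are equal. *)
Lemma dominant_unique w s : integral_diff w -> dominant w -> dominant (wact s w) ->
  wact s w = w.
Proof.
case/integral_coords => c [k wk].
have wks i : wact s w 0 i = c + (k (s i))%:R by rewrite mxE.
rewrite (dominant_sorted wk) (dominant_sorted wks) => s1 s2.
have pe : perm_eq [tuple k (s i) | i < n] [tuple k i | i < n].
  by apply/tuple_permP; exists s; congr (tval _); apply: eq_from_tnth => i; rewrite !tnth_mktuple.
have /val_inj e := sorted_eq geq_trans geq_anti s2 s1 pe.
apply/rowP => i; rewrite wks wk; congr (_ + _%:R).
by have := congr1 (fun t => tnth t i) e; rewrite !tnth_mktuple.
Qed.

End Dot.

(** * Weight decomposition of an irreducible representation *)

Section Weights.
Variables (F : closedFieldType) (charF0 : [pchar F] =i pred0) (n N : nat).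
Variables (phi : 'M[F]_n -> 'M[F]_N) (Hrep : is_lie_rep phi) (Hirr : irreducible_rep phi).
Implicit Types (w d : 'rV[F]_n).

Lemma stable_of_gens (U : 'M[F]_N) :
    (forall i j, i != j -> stablemx U (phi (delta_mx i j))^T) ->
    (forall d, \sum_i d 0 i = 0 -> stablemx U (phi (diag_mx d))^T) ->
  forall X, in_sl X -> stablemx U (phi X)^T.
Proof.
move=> hd hh X /in_slP sX; rewrite [X]sl_decomp.
have sl1 i j : j != i -> in_sl (X i j *: delta_mx i j : 'M[F]_n).
  by move=> ne; apply/in_slZ/delta_sl; rewrite eq_sym.
have sl2 i : in_sl (\sum_(j | j != i) X i j *: delta_mx i j : 'M[F]_n).
  by apply: in_sl_sum => j; apply: sl1.
have s0 : \sum_i (\row_i X i i) 0 i = 0.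
  by rewrite -[RHS]sX; apply: eq_bigr => i _; rewrite mxE.
have sl3 : in_sl (diag_mx (\row_i X i i)) by rewrite in_sl_diag s0.
rewrite phiD //; last by apply: in_sl_sum => i _.
rewrite (phi_sum Hrep) // linearD /= stablemxD ?hh // linear_sum /=.
apply: (big_ind (fun M => stablemx U M)) => [|A B|i _]; [exact: stablemx0|exact: stablemxD|].
rewrite (phi_sum Hrep); last by move=> j; apply: sl1.
rewrite [(\sum_(_ | _) _)^T]linear_sum /=.
apply: (big_ind (fun M => stablemx U M)) => [|A B|j ne]; [exact: stablemx0|exact: stablemxD|].
rewrite phiZ // ?delta_sl // 1?eq_sym //.
by rewrite linearZ /= -scalemxAr scalemx_sub // hd // eq_sym.
Qed.

(** Let [U] be the sum of all eigenspaces. Root vectors shift eigenvalues and diagonal matrices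
    commute, so [U] is stable under sl(n). It is nonzero because [F] is algebraically closed, hence
    it is V by irreducibility. *)
Lemma phi_diag_diagonalizable d : \sum_i d 0 i = 0 ->
  exists2 P : 'M[F]_N, P \in unitmx & similar_diag P (phi (diag_mx d))^T.
Proof.
move=> sd; set A := (phi (diag_mx d))^T.
have [rs ers] := closed_field_poly_normal (char_poly A).
rewrite (monicP (char_poly_monic A)) scale1r in ers.
pose us := undup rs; pose U := (\sum_(i < size us) eigenspace A us`_i)%MS.
have eigU x : (eigenspace A x <= U)%MS.
  have [->|nz] := eqVneq (eigenspace A x) 0; first exact: sub0mx.
  have : x \in us.
    by rewrite mem_undup -root_prod_XsubC -ers -eigenvalue_root_char.
  move=> /(nthP 0)[i lti <-]; exact: (sumsmx_sup (Ordinal lti)).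
apply/diagonalizablePeigen; exists us; first exact: undup_uniq.
rewrite (big_nth 0) big_mkord.
suff fU : row_full U by apply/eqmxP; rewrite submx1 sub1mx.
have comm X c : in_sl X -> diag_mx d *m X - X *m diag_mx d = c *: X -> stablemx U (phi X)^T.
  move=> sX hX; rewrite sumsmxMr; apply/sumsmx_subP => k _.
  apply: submx_trans (eigU (us`_k + c)); apply/eigenspaceP.
  have /eigenspaceP e := submx_refl (eigenspace A us`_k).
  have slD : in_sl (diag_mx d) by rewrite in_sl_diag sd.
  rewrite -mulmxA -trmx_mul (phi_mulC Hrep slD sX) hX phiZ // linearD linearZ /= trmx_mul.
  by rewrite mulmxDr mulmxA e -scalemxAl -scalemxAr -scalerDl.
have st : forall X, in_sl X -> stablemx U (phi X)^T.
  apply: stable_of_gens => [i j ne|d' sd'].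
    by apply: comm (diag_delta_comm d i j); apply: delta_sl.
  apply: (comm _ 0); first by rewrite in_sl_diag sd'.
  by rewrite scale0r diag_mxC subrr.
have [N0 /(_ U st)/orP[/eqP U0|//]] := Hirr.
have /closed_rootP[x] : size (char_poly A) != 1%N.
  by rewrite size_char_poly eqSS -lt0n.
rewrite -eigenvalue_root_char => /negP[]; rewrite -submx0.
by rewrite -[X in (_ <= X)%MS]U0.
Qed.

(** Commuting diagonalizable matrices are diagonalized together; the rows of [B] are weight vectors
    and [ws] lists their weights with multiplicity. *)
Lemma weight_basis : exists (B : 'M[F]_N) (ws : 'I_N -> 'rV[F]_n), [/\ B \in unitmx,
  forall a, is_weight_rep (ws a) &
  forall d, \sum_i d 0 i = 0 ->
    B *m (phi (diag_mx d))^T = diag_mx (\row_a wdot (ws a) d) *m B].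
Proof.
(* The traceless parts of the diagonal units: a trace-zero [d] is their combination with
   coefficients [d 0 i]. *)
pose k i : 'rV[F]_n := delta_mx 0 i - const_mx n%:R^-1.
have n0 (i : 'I_n) : n%:R != 0 :> F.
  by rewrite ((pcharf0P F).1 charF0) -lt0n (leq_ltn_trans _ (ltn_ord i)).
have sk i : \sum_j k i 0 j = 0.
  under eq_bigr => j _ do rewrite !mxE; rewrite sumrB sumr_const card_ord.
  rewrite (bigD1 i) //= !eqxx big1 ?addr0; last by move=> j /negPf ->.
  by rewrite -[_ *+ n]mulr_natr mulVf ?subrr ?(n0 i).
have slk i : in_sl (diag_mx (k i)) by rewrite in_sl_diag sk.
pose As := [seq (phi (diag_mx (k i)))^T | i <- enum 'I_n].
have [|B uB /allP BA] := (codiagonalizableP As).1.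
  split=> [_ _ /mapP[i _ ->] /mapP[j _ ->]|_ /mapP[i _ ->]]; last first.
    exact: phi_diag_diagonalizable.
  by rewrite /comm_mx -!trmx_mul (phi_mulC Hrep) // diag_mxC subrr phi0 // addr0.
have exD i : exists D, B *m (phi (diag_mx (k i)))^T = diag_mx D *m B.
  have /BA/diagonalizable_forPex[D /(simmxP uB) ->] : (phi (diag_mx (k i)))^T \in As.
    by apply: map_f; rewrite mem_enum.
  by exists D.
have [D DP] := fin_all_exists exD.
exists B, (fun a => \row_i D i 0 a).
have main d : \sum_i d 0 i = 0 ->
    B *m (phi (diag_mx d))^T = diag_mx (\row_a wdot (\row_i D i 0 a) d) *m B.
  move=> sd; have -> : diag_mx d = \sum_i d 0 i *: diag_mx (k i).
    rewrite -[RHS](_ : diag_mx (\sum_i d 0 i *: k i) = _); last first.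
      by rewrite linear_sum /=; apply: eq_bigr => i _; rewrite linearZ.
    congr diag_mx; rewrite {1}[d]row_sum_delta.
    under [RHS]eq_bigr => i _ do rewrite /k scalerBr.
    by rewrite sumrB -scaler_suml sd scale0r subr0; apply: eq_bigr => i _.
  rewrite (phi_sum Hrep) => [|i _]; last exact: in_slZ.
  rewrite linear_sum mulmx_sumr /=.
  rewrite (eq_bigr (fun i => d 0 i *: (diag_mx (D i) *m B))) => [|i _]; last first.
    by rewrite phiZ // linearZ /= -scalemxAr DP.
  rewrite (eq_bigr (fun i => (d 0 i *: diag_mx (D i)) *m B)) => [|i _]; last first.
    by rewrite scalemxAl.
  rewrite -mulmx_suml; congr (_ *m _).
  apply/matrixP => a b; rewrite !mxE summxE /wdot.
  under eq_bigr => i _ do rewrite !mxE.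
  case: eqP => [_|_]; last by rewrite mulr0n big1 // => i _; rewrite mulr0n mulr0.
  by rewrite mulr1n; apply: eq_bigr => i _; rewrite !mxE mulr1n mulrC.
split=> // a.
(* This relation among the [k i] is what makes the coordinates of each weight sum to 0. *)
have e : \sum_i diag_mx (k i) = 0.
  rewrite -linear_sum /=; apply/matrixP => i j; rewrite !mxE summxE.
  rewrite (eq_bigr (fun l => k l 0 i)) // /k.
  under eq_bigr => l _ do rewrite !mxE eqxx /=.
  rewrite sumrB sumr_const card_ord (bigD1 i) //= eqxx big1 ?addr0; last first.
    by move=> l /negPf ne; rewrite eq_sym ne.
  by rewrite -[_ *+ n]mulr_natr mulVf ?subrr ?(n0 i) ?mul0rn.
have : diag_mx (\sum_i D i) *m B = 0.
  rewrite linear_sum mulmx_suml /= (eq_bigr (fun i => B *m (phi (diag_mx (k i)))^T)) => [|i _].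
    by rewrite -mulmx_sumr -linear_sum -(phi_sum Hrep) // e phi0 // linear0 mulmx0.
  by rewrite DP.
move/(congr1 (fun M => M *m invmx B)); rewrite mulmxK // mul0mx => /matrixP/(_ a a).
rewrite !mxE eqxx mulr1n summxE => z; rewrite /is_weight_rep -[X in _ == X]z.
by apply/eqP/eq_bigr => i _; rewrite mxE.
Qed.

Section WeightBasis.
Variables (B : 'M[F]_N) (ws : 'I_N -> 'rV[F]_n).
Hypotheses (uB : B \in unitmx) (ws_rep : forall a, is_weight_rep (ws a)).
Hypothesis (phiB : forall d, \sum_i d 0 i = 0 ->
    B *m (phi (diag_mx d))^T = diag_mx (\row_a wdot (ws a) d) *m B).

Lemma Hmx_dsum j : (j < n.-1)%N ->
  \sum_i (\row_a ((val a == j)%:R - (val a == j.+1)%:R) : 'rV[F]_n) 0 i = 0.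
Proof. by move=> ltj; apply/eqP; rewrite -in_sl_diag -Hmx_diag Hmx_sl. Qed.

Definition wproj w : 'M[F]_N := diag_mx (\row_a (ws a == w)%:R).

(** If a weight vector has a nonzero coordinate [a] in the basis [B], then [ws a] and [w] agree on
    every [Hmx], hence are equal. *)
Lemma wspace_eq w : is_weight_rep w ->
  (wspace phi w :=: wproj w *m B)%MS.
Proof.
move=> rw; apply/eqmxP/andP; split.
  apply/rV_subP => v /sub_bigcapmxP hv.
  have [u vE] : exists u, v = u *m B by exists (v *m invmx B); rewrite mulmxKV.
  suff uE : u = u *m wproj w by rewrite vE uE -mulmxA submxMl.
  rewrite mul_mx_diag; apply/rowP => a; rewrite !mxE.
  have [->|un0] := eqVneq (u 0 a) 0; first by rewrite mul0r.
  suff -> : ws a = w by rewrite eqxx mulr1.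
  apply: (weight_ext charF0) => // j ltj.
  have /eigenspaceP := hv (Ordinal ltj) isT => /=.
  rewrite {1}vE -mulmxA [in (phi _)^T]Hmx_diag phiB ?Hmx_dsum // mulmxA vE scalemxAl.
  move/(can_inj (mulmxK uB)); rewrite mul_mx_diag => /rowP/(_ a); rewrite !mxE -wval_diag -Hmx_diag.
  by rewrite mulrC => /(mulIf un0).
apply/sub_bigcapmxP => j _; apply/eigenspaceP.
rewrite -mulmxA [in (phi _)^T]Hmx_diag phiB ?Hmx_dsum // mulmxA scalemxAl; congr (_ *m _).
rewrite mulmx_diag -linearZ; congr diag_mx; apply/rowP => a; rewrite !mxE -wval_diag -Hmx_diag.
by case: eqP => [->|_]; rewrite ?mul0r ?mulr0 // mul1r mulr1.
Qed.

Lemma wmultE w : is_weight_rep w -> wmult phi w = #|[pred a | ws a == w]|.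
Proof.
move=> rw; rewrite /wmult (wspace_eq rw) mxrankMfree ?row_free_unit //.
exact: (rank_diag_pred F [pred a | ws a == w]).
Qed.

Lemma wspace_phi w d : is_weight_rep w -> \sum_i d 0 i = 0 ->
  wspace phi w *m (phi (diag_mx d))^T = wdot w d *: wspace phi w.
Proof.
move=> rw sd; have /submxP[M ->] : (wspace phi w <= wproj w *m B)%MS.
  by rewrite (wspace_eq rw).
rewrite -!mulmxA phiB // scalemxAr; congr (_ *m _); rewrite mulmxA scalemxAl; congr (_ *m _).
rewrite mulmx_diag -linearZ; congr diag_mx; apply/rowP => a; rewrite !mxE.
by case: eqP => [->|_]; rewrite ?mul0r ?mulr0 // mul1r mulr1.
Qed.

Lemma sub_wspace w m (M : 'M[F]_(m, N)) :
  (forall d, \sum_i d 0 i = 0 -> M *m (phi (diag_mx d))^T = wdot w d *: M) ->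
  (M <= wspace phi w)%MS.
Proof.
move=> h; apply/sub_bigcapmxP => j _; apply/eigenspaceP.
by rewrite Hmx_diag h ?Hmx_dsum // wval_diag.
Qed.

(** The intertwiner of the permutation matrix embeds one weight space into the other; the same for
    the inverse permutation gives equality. *)
Lemma leq_wmult_act w s : is_weight_rep w -> (wmult phi w <= wmult phi (wact s w))%N.
Proof.
move=> rw; have [g ug gP] := intertwined_diag charF0 Hrep (unitmx_perm F s).
rewrite /wmult -(@mxrankMfree _ _ _ _ (wspace phi w) g^T) ?row_free_unit ?unitmx_tr //.
apply/mxrankS/sub_wspace => d sd.
have [d' dE sd'] : exists2 d', d = wact s d' & \sum_i d' 0 i = 0.
  by exists (wact s^-1%g d); rewrite ?wactKV // sum_act.
rewrite -mulmxA -trmx_mul dE wdot_act -perm_diag_conj -gP // trmx_mul mulmxA.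
by rewrite wspace_phi // scalemxAl.
Qed.

Lemma wmult_act w s : is_weight_rep w -> wmult phi (wact s w) = wmult phi w.
Proof.
move=> rw; apply/eqP; rewrite eqn_leq leq_wmult_act // andbT.
have {2}<- := wactK s w; apply: leq_wmult_act.
by rewrite /is_weight_rep sum_act.
Qed.

(** The matrices [delta_mx i j], [delta_mx j i] and [diag_mx d] form an sl(2) triple, and the last
    one acts on the basis vector [a] by the difference of the coordinates [i] and [j]. *)
Lemma ws_integral a : integral_diff (ws a).
Proof.
move=> i j; have [->|ne] := eqVneq i j; first by exists 0%N, 0%N; rewrite !subrr.
pose d : 'rV[F]_n := delta_mx 0 i - delta_mx 0 j.
have dE l : d 0 l = (l == i)%:R - (l == j)%:R by rewrite !mxE.
have diag_delta (l : 'I_n) : diag_mx (delta_mx 0 l) = delta_mx l l :> 'M[F]_n.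
  apply/matrixP => x y; rewrite !mxE eqxx /=.
  by case: (x =P l) => [->|_]; rewrite ?mul0rn //= eq_sym.
have wd l : \sum_m ws a 0 m * (m == l)%:R = ws a 0 l.
  by rewrite (bigD1 l) //= eqxx mulr1 big1 ?addr0 // => m /negPf ->; rewrite mulr0.
have sd1 (l : 'I_n) : \sum_m (m == l)%:R = 1 :> F.
  by rewrite (bigD1 l) //= eqxx big1 ?addr0 // => m /negPf ->.
have sd : \sum_l d 0 l = 0.
  by under eq_bigr => l _ do rewrite dE; rewrite sumrB !sd1 subrr.
have slD : in_sl (diag_mx d) by rewrite in_sl_diag sd.
have sle : in_sl (delta_mx i j : 'M[F]_n) by apply: delta_sl.
have slf : in_sl (delta_mx j i : 'M[F]_n) by apply: delta_sl; rewrite eq_sym.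
have di : d 0 i = 1 by rewrite dE eqxx (negPf ne) subr0.
have dj : d 0 j = -1 by rewrite dE eqxx eq_sym (negPf ne) sub0r.
have two : 2%:R = 1 + 1 :> F by [].
have He : diag_mx d *m delta_mx i j - delta_mx i j *m diag_mx d = 2%:R *: delta_mx i j.
  by rewrite diag_delta_comm di dj opprK.
have Hf : diag_mx d *m delta_mx j i - delta_mx j i *m diag_mx d = - 2%:R *: delta_mx j i.
  by rewrite diag_delta_comm di dj two opprD.
have n2 : 2%:R != 0 :> F by apply: (natS_neq0 charF0).
have [K eK] := phi_nilpotent charF0 Hrep slD sle n2 He.
have [K' fK] : exists K', phi (delta_mx j i) ^+ K' = 0.
  by apply: (phi_nilpotent charF0 Hrep slD slf _ Hf); rewrite oppr_eq0.
have v0 : (row a B)^T != 0.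
  apply/eqP => /(congr1 trmx); rewrite trmxK linear0 rowE => /(congr1 (fun M => M *m invmx B)).
  by rewrite mulmxK // mul0mx => /matrixP/(_ 0 a)/eqP; rewrite !mxE !eqxx oner_eq0.
apply: (sl2_eigenvalue_int charF0 (h := phi (diag_mx d)) _ _ _ eK fK v0).
- by rewrite -Hrep.2 // He (phiZ Hrep).
- by rewrite -Hrep.2 // Hf (phiZ Hrep).
- rewrite -Hrep.2 // !mul_delta_mx; congr phi; rewrite linearB /=.
  by rewrite !diag_delta.
- rewrite -[phi _]trmxK -trmx_mul -row_mul phiB // row_mul row_diag_mx -scalemxAl -rowE.
  rewrite linearZ /= mxE; congr (_ *: _); rewrite /wdot.
  under eq_bigr => l _ do rewrite dE mulrBr; rewrite sumrB.
  by rewrite !wd.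
Qed.

(** Each weight of the basis is conjugate to exactly one member of [mus]. The product over the basis
    is thus regrouped by orbits, and multiplicities are constant on an orbit. *)
Lemma det_phi_diag (mus : seq 'rV[F]_n) (Huniq : uniq mus)
  (Hmus : forall w, w \in mus <->
            [/\ is_weight_rep w, dominant w & (0 < wmult phi w)%N]) z0 d :
  \sum_i d 0 i = 0 ->
  \det (z0%:M + phi (diag_mx d)) =
    \prod_(w <- mus) (\prod_(nu <- worbit w) (z0 + wdot nu d)) ^+ wmult phi w.
Proof.
move=> sd; rewrite -det_tr linearD /= tr_scalar_mx.
have -> : z0%:M + (phi (diag_mx d))^T =
    invmx B *m diag_mx (\row_a (z0 + wdot (ws a) d)) *m B.
  rewrite -[LHS](mulKmx uB) -mulmxA; congr (_ *m _).
  rewrite mulmxDr phiB // scalar_mxC -mulmxDl; congr (_ *m _).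
  rewrite -diag_const_mx -linearD /=; congr diag_mx.
  by apply/rowP => a; rewrite !mxE.
rewrite !det_mulmx mulrAC det_inv mulVf ?mul1r; last by move: uB; rewrite unitmxE unitfE.
rewrite det_diag.
(* In the double product attached to [a], a single pair of [w] and [nu] contributes a factor. *)
transitivity (\prod_a \prod_(w <- mus) \prod_(nu <- worbit w | ws a == nu) (z0 + wdot nu d)).
  apply: eq_bigr => a _; rewrite mxE.
  have [s dom] := dominant_exists charF0 (ws_integral a).
  have wm : wact s (ws a) \in mus.
    apply/Hmus; split=> //; first by rewrite /is_weight_rep sum_act; apply: ws_rep.
    by rewrite wmult_act // wmultE // (cardD1 a) inE eqxx.
  have ao : ws a \in worbit (wact s (ws a)) by apply/worbitP; exists s^-1%g; rewrite wactK.
  rewrite (bigD1_seq _ wm Huniq) /= [X in _ * X]big1_seq ?mulr1 => [|w /andP[ne win]].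
    rewrite big_mkcond (bigD1_seq _ ao (undup_uniq _)) /= eqxx big1 ?mulr1 // => nu.
    by rewrite eq_sym => /negPf ->.
  rewrite big1_seq // => nu /andP[/eqP <- /worbitP[t te]].
  case/eqP: ne; rewrite te; have [rw domw _] := (Hmus w).1 win.
  rewrite wactM; symmetry; apply: (dominant_unique charF0) => //; last by rewrite -wactM -te.
  by have := @ws_integral a => h i j; have := h (t^-1%g i) (t^-1%g j); rewrite te !mxE !permKV.
rewrite exchange_big /=; apply: eq_big_seq => w win; rewrite -prodrXl.
rewrite (exchange_big_dep xpredT) //=; apply: eq_big_seq => nu /worbitP[s ->].
have [rw _ _] := (Hmus w).1 win.
by rewrite prodr_const -(wmult_act s rw) wmultE; last by rewrite /is_weight_rep sum_act.
Qed.

End WeightBasis.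
End Weights.

(** * Characteristic polynomials and diagonalizability *)

Section CharPoly.
Variables (F : fieldType) (n : nat).

Lemma char_poly_conj (P A : 'M[F]_n) : P \in unitmx ->
  char_poly (invmx P *m A *m P) = char_poly A.
Proof.
move=> uP; rewrite /char_poly.
have -> : char_poly_mx (invmx P *m A *m P) =
    map_mx polyC (invmx P) *m char_poly_mx A *m map_mx polyC P.
  rewrite /char_poly_mx mulmxBr mulmxBl !map_mxM; congr (_ - _).
  by rewrite scalar_mxC -mulmxA -map_mxM mulVmx // map_mx1 mulmx1.
by rewrite !det_mulmx mulrAC -det_mulmx -map_mxM mulVmx // map_mx1 det1 mul1r.
Qed.

Lemma char_poly_diag (d : 'rV[F]_n) : char_poly (diag_mx d) = \prod_i ('X - (d 0 i)%:P).
Proof.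
rewrite char_poly_trig; first by apply: eq_bigr => i _; rewrite mxE eqxx mulr1n.
by apply/is_trig_mxP => i j ltij; rewrite mxE; case: eqP ltij => [->|]; rewrite ?ltnn ?mulr0n.
Qed.

Lemma char_poly_diag_with (L : 'M[F]_n) d : diag_with L d ->
  char_poly L = \prod_i ('X - (d 0 i)%:P).
Proof. by case=> P [uP ->]; rewrite char_poly_conj // char_poly_diag. Qed.

End CharPoly.

Section SplitCharPoly.
Variables (F : closedFieldType) (n : nat).

Lemma char_poly_split (L : 'M[F]_n) : exists d : 'rV[F]_n, char_poly L = \prod_i ('X - (d 0 i)%:P).
Proof.
have [rs ers] := closed_field_poly_normal (char_poly L).
rewrite (monicP (char_poly_monic L)) scale1r in ers.
have srs : size rs = n.
  by have := size_char_poly L; rewrite ers size_prod_XsubC => -[].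
exists (\row_i rs`_i); rewrite ers (big_nth 0) big_mkord srs.
by apply: eq_bigr => i _; rewrite mxE.
Qed.

(** The minimal polynomial divides the characteristic one, here a product of distinct linear
    factors. *)
Lemma distinct_diag_with (L : 'M[F]_n) (d : 'rV[F]_n) :
  char_poly L = \prod_i ('X - (d 0 i)%:P) -> injective (d 0) ->
  exists d', diag_with L d'.
Proof.
case: n L d => [|m] L d cpL dinj.
  by exists 0, 1%:M; rewrite unitmx1; split=> //; apply/matrixP => -[].
have [|P uP /diagonalizable_forPex[D /(simmxP uP) PL]] := (diagonalizableP L).2.
  exists [seq d 0 i | i <- enum 'I_m.+1]; first by rewrite map_inj_uniq ?enum_uniq.
  by rewrite big_map big_enum /= -cpL mxminpoly_dvd_char.
by exists D, P; split=> //; rewrite -mulmxA -PL mulKmx.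
Qed.

End SplitCharPoly.

(** * Coordinates in the Chevalley basis *)

Section Coordinates.
Variables (F : fieldType) (charF0 : [pchar F] =i pred0) (n : nat).
Local Notation dsl := (dsl n).

Lemma size_chev : size (chev F n) == dsl.
Proof.
rewrite size_cat !size_map size_iota /dsl -cardE.
have e : (#|[pred p : 'I_n * 'I_n | p.1 != p.2]| + n = n * n)%N.
  have := cardC [pred p : 'I_n * 'I_n | p.1 == p.2]; rewrite card_prod card_ord addnC => <-.
  congr (_ + _)%N.
  rewrite -[LHS](card_ord n) -(card_codom (f := fun i : 'I_n => (i, i))) ; last by move=> i j [].
  apply: eq_card => -[i j]; rewrite !inE /=; apply/codomP/eqP => [[k [-> ->]]//|->].
  by exists j.
case: (n) e => [|m]; first by rewrite addn0 muln0 => ->.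
by move=> e; apply/eqP; rewrite -e addnS.
Qed.

Definition tchev : dsl.-tuple 'M[F]_n := Tuple size_chev.

Lemma LofE (c : 'I_dsl -> F) : Lof c = \sum_i c i *: tchev`_i.
Proof. by []. Qed.

Lemma chev_sl X : X \in chev F n -> in_sl X.
Proof.
rewrite mem_cat => /orP[] /mapP[].
  by move=> p; rewrite mem_enum inE => ne ->; apply: delta_sl.
by move=> j; rewrite mem_iota add0n => /andP[_ ltj] ->; apply: Hmx_sl.
Qed.

Lemma chevb_sl (i : 'I_dsl) : in_sl (chevb F n i).
Proof. by apply/chev_sl/mem_nth; rewrite (eqP size_chev). Qed.

Lemma Lof_sl (c : 'I_dsl -> F) : in_sl (Lof c).
Proof. by apply: in_sl_sum => i _; apply/in_slZ/chevb_sl. Qed.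

Lemma delta_chev (i j : 'I_n) : i != j -> (delta_mx i j : 'M[F]_n) \in <<tchev>>%VS.
Proof.
move=> ne; apply: memv_span; rewrite mem_cat; apply/orP; left.
by apply/mapP; exists (i, j); rewrite // mem_enum inE.
Qed.

(** The [Hmx] telescope from the first index to any other. *)
Lemma diag_chev (i j : 'I_n) : (delta_mx i i - delta_mx j j : 'M[F]_n) \in <<tchev>>%VS.
Proof.
have n0 : (0 < n)%N by apply: leq_ltn_trans (ltn_ord i).
have h (l : 'I_n) : (delta_mx l l - delta_mx (Ordinal n0) (Ordinal n0) : 'M[F]_n) \in <<tchev>>%VS.
  case: l => l; elim: l => [|l IHl] ltl.
    by rewrite (_ : Ordinal ltl = Ordinal n0) ?subrr ?mem0v //; apply: val_inj.
  have ltl' := ltnW ltl; have := IHl ltl'.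
  suff : (delta_mx (Ordinal ltl') (Ordinal ltl') - delta_mx (Ordinal ltl) (Ordinal ltl) : 'M[F]_n)
      \in <<tchev>>%VS.
    by move=> h1 h2; have := rpredB h2 h1; rewrite opprB addrC addrA subrK.
  apply: memv_span; rewrite mem_cat; apply/orP; right; apply/mapP; exists l.
    by rewrite mem_iota /=; lia.
  rewrite Hmx_diag; apply/matrixP => a b; rewrite !mxE -!val_eqE /=.
  case: (nat_of_ord a =P l) => [->|_] /=.
    by rewrite (ltn_eqF (ltnSn l)) /= !subr0 [in RHS]eq_sym.
  rewrite !sub0r; case: (nat_of_ord a =P l.+1) => [->|_] /=.
    by rewrite eq_sym; case: (_ == _); rewrite ?mulr1n ?mulr0n ?oppr0.
  by rewrite oppr0 mul0rn.
by have := rpredB (h i) (h j); rewrite opprB addrA subrK.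
Qed.

Lemma sl_chev X : in_sl X -> X \in <<tchev>>%VS.
Proof.
move=> /in_slP sX; rewrite [X]sl_decomp; apply: rpredD.
  by apply: rpred_sum => i _; apply: rpred_sum => j ne; apply/rpredZ/delta_chev; rewrite eq_sym.
have [n0|n0] := posnP n.
  rewrite (_ : diag_mx _ = 0) ?mem0v //; apply/matrixP => i.
  by have := ltn_ord i; rewrite [X in (_ < X)%N]n0.
pose o := Ordinal n0; rewrite diag_mx_sum_delta.
have -> : \sum_i (\row_i X i i) 0 i *: delta_mx i i =
    \sum_i X i i *: (delta_mx i i - delta_mx o o) :> 'M[F]_n.
  under [RHS]eq_bigr => i _ do rewrite scalerBr.
  rewrite sumrB -scaler_suml -/(\tr X) sX scale0r subr0.
  by apply: eq_bigr => i _; rewrite mxE.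
by apply: rpred_sum => i _; apply/rpredZ/diag_chev.
Qed.

(** Dimension count: one additional diagonal unit completes the span to all matrices, so the [dsl]
    elements span [dsl] dimensions. *)
Lemma free_chev : free tchev.
Proof.
rewrite /free eqn_leq dim_span size_tuple /=.
have [n0|n0] := posnP n; first by rewrite /dsl n0.
pose o := Ordinal n0.
have : (fullv <= <<tchev>> + <[delta_mx o o : 'M[F]_n]>)%VS.
  apply/subvP => X _; rewrite -[X](subrK (\tr X *: delta_mx o o)).
  apply: memv_add; last by rewrite memvZ ?memv_line.
  apply: sl_chev; apply/in_slP; rewrite linearB linearZ /=.
  rewrite [\tr (delta_mx o o)](_ : _ = 1) ?mulr1 ?subrr // /mxtrace (bigD1 o) //= mxE !eqxx.
  by rewrite big1 ?addr0 // => i /negPf ne; rewrite mxE ne.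
move/dimvS; rewrite dimvf dim_matrix => le.
rewrite /dsl -subn1 leq_subLR addnC (leq_trans le) //.
by rewrite (leq_trans (dimv_add_leqif _ _)) // leq_add2l dim_vline leq_b1.
Qed.

Definition cof (X : 'M[F]_n) (i : 'I_dsl) : F := coord tchev i X.

Lemma cofK X : in_sl X -> Lof (cof X) = X.
Proof. by move=> sX; rewrite LofE [RHS](coord_span (sl_chev sX)). Qed.

Lemma LofK (c : 'I_dsl -> F) i : cof (Lof c) i = c i.
Proof. by rewrite /cof LofE coord_sum_free ?free_chev. Qed.

Lemma cofZ a X i : cof (a *: X) i = a * cof X i.
Proof. by rewrite /cof linearZ. Qed.

Lemma cof_sum (I : Type) (r : seq I) (P : pred I) (X : I -> 'M[F]_n) i :
  cof (\sum_(j <- r | P j) X j) i = \sum_(j <- r | P j) cof (X j) i.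
Proof. by rewrite /cof linear_sum. Qed.

End Coordinates.

(** * Orbital factors and the discriminant as polynomials in the coordinates *)

Section Evaluation.
Variables (F : fieldType) (n N : nat).
Local Notation dsl := (dsl n).

Lemma evpt0 z0 (c : 'I_dsl -> F) : evpt z0 c ord0 = z0.
Proof. by rewrite /evpt unlift_none. Qed.

Lemma evptS z0 (c : 'I_dsl -> F) i : evpt z0 c (lift ord0 i) = c i.
Proof. by rewrite /evpt liftK. Qed.

Lemma evpt_surj (v : 'I_dsl.+1 -> F) : v =1 evpt (v ord0) (fun i => v (lift ord0 i)).
Proof. by move=> j; rewrite /evpt; case: unliftP => [i|] ->. Qed.

Lemma eq_evpt z0 (c c' : 'I_dsl -> F) : c =1 c' -> evpt z0 c =1 evpt z0 c'.
Proof. by move=> e j; rewrite /evpt; case: unlift. Qed.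

Definition Lgen : 'M[PR F n]_n :=
  \sum_(i < dsl) 'X_(lift ord0 i) *: map_mx (@mpolyC dsl.+1 F) (chevb F n i).

Lemma map_Lgen z0 (c : 'I_dsl -> F) : map_mx (meval (evpt z0 c)) Lgen = Lof c.
Proof.
apply/matrixP => a b; rewrite mxE /Lgen summxE rmorph_sum summxE; apply: eq_bigr => i _.
by rewrite !mxE /= mevalM mevalXU mevalC evptS.
Qed.

Lemma meval_char_Lgen z0 (c : 'I_dsl -> F) k :
  ((char_poly Lgen)`_k).@[evpt z0 c] = (char_poly (Lof c))`_k.
Proof. by rewrite -(map_Lgen z0 c) -map_char_poly coef_map. Qed.

Lemma meval_fphi (phi : 'M[F]_n -> 'M[F]_N) (Hrep : is_lie_rep phi) z0 c :
  (fphi phi).@[evpt z0 c] = \det (z0%:M + phi (Lof c)).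
Proof.
rewrite /fphi -det_map_mx; congr (\det _); apply/matrixP => a b.
rewrite !mxE /= mevalD mevalMn mevalXU evpt0 rmorph_sum /Lof /=; congr (_ + _).
rewrite (phi_sum Hrep) => [|i _]; last exact/in_slZ/chevb_sl.
rewrite summxE; apply: eq_bigr => i _.
by rewrite mevalM mevalXU mevalC evptS (phiZ Hrep) ?chevb_sl // mxE.
Qed.

(** Eigenvalues with multiplicity, available also when [L] is not diagonalizable. *)
Definition spectrum (L : 'M[F]_n) (d : 'rV[F]_n) := char_poly L = \prod_i ('X - (d 0 i)%:P).

(** The elementary symmetric polynomials of the eigenvalues are, up to sign, coefficients of the
    characteristic polynomial of [Lgen]; substituting these gives [q]. The sigma type lets
    definitions extract [q]. *)
Lemma sym_lift (p : {mpoly F[n]}) : p \is symmetric ->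
  {q : PR F n | forall z0 c d, spectrum (Lof c) d -> q.@[evpt z0 c] = p.@[d 0]}.
Proof.
case/sym_fundamental => t [tp _].
exists (t \mPo [tuple (-1) ^+ i.+1 * (char_poly Lgen)`_(n - i.+1) | i < n]) => z0 c d sp.
rewrite -tp !comp_mpoly_meval; apply: meval_eq => i; rewrite !tnth_mktuple mevalM.
rewrite rmorphXn rmorphN rmorph1 /= meval_char_Lgen sp.
have -> : \prod_i ('X - (d 0 i)%:P) = \prod_(x <- [tuple d 0 i | i < n]) ('X - x%:P).
  by rewrite big_tuple; apply: eq_bigr => j _; rewrite tnth_mktuple.
have := mroots_coeff [tuple d 0 i | i < n] (lift ord0 i); rewrite /= /bump /= add1n => ->.
rewrite mulrA -expr2 -exprM mulnC exprM sqrrN expr1n expr1n mul1r.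
by apply: meval_eq => j; rewrite tnth_mktuple.
Qed.

Definition linform (w : 'rV[F]_n) : {mpoly F[n]} := \sum_i w 0 i *: 'X_i.

Lemma meval_linform w (d : 'rV[F]_n) : (linform w).@[d 0] = wdot w d.
Proof. by rewrite rmorph_sum /=; apply: eq_bigr => i _; rewrite mevalZ mevalXU. Qed.

Lemma msymXi s (i : 'I_n) : msym s ('X_i : {mpoly F[n]}) = 'X_(s i).
Proof.
rewrite msymX; congr 'X_[_]; apply/mnmP => j; rewrite !mnmE; congr (nat_of_bool _).
by rewrite -(inj_eq (@perm_inj _ s)) permKV.
Qed.

Lemma msym_linform s w : msym s (linform w) = linform (wact s^-1%g w).
Proof.
rewrite /linform linear_sum [RHS](reindex_inj (@perm_inj _ s)) /=; apply: eq_bigr => i _.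
by rewrite linearZ /= mxE permK msymXi.
Qed.

(** The orbital factor in terms of eigenvalue variables, with [z0] as the outer variable; its
    coefficients are then lifted one by one. *)
Definition orbpoly (w : 'rV[F]_n) : {poly {mpoly F[n]}} :=
  \prod_(nu <- worbit w) ('X + (linform nu)%:P).

Lemma perm_worbit s (w : 'rV[F]_n) : perm_eq [seq wact s nu | nu <- worbit w] (worbit w).
Proof.
apply: uniq_perm; rewrite ?undup_uniq //.
  by rewrite map_inj_uniq ?undup_uniq //; exact: (can_inj (wactK s)).
move=> nu; apply/mapP/idP => [[nu' /worbitP[t ->] ->]|/worbitP[t ->]].
  by apply/worbitP; exists (s * t)%g; rewrite wactM.
exists (wact (s^-1 * t)%g w); last by rewrite wactM mulKVg.
by apply/worbitP; exists (s^-1 * t)%g.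
Qed.

Lemma orbpoly_sym w k : (orbpoly w)`_k \is symmetric.
Proof.
apply/issymP => s; suff e : map_poly (msym s) (orbpoly w) = orbpoly w.
  by rewrite -coef_map /= e.
rewrite /orbpoly rmorph_prod /=.
apply: etrans (perm_big _ (perm_worbit s^-1%g w)); rewrite big_map.
by apply: eq_bigr => nu _; rewrite rmorphD /= map_polyX map_polyC /= msym_linform.
Qed.

Definition orbfac (w : 'rV[F]_n) : PR F n :=
  \sum_(k < size (orbpoly w)) sval (sym_lift (orbpoly_sym w k)) * 'X_ord0 ^+ k.

Lemma meval_orbfac w z0 c d : spectrum (Lof c) d ->
  (orbfac w).@[evpt z0 c] = \prod_(nu <- worbit w) (z0 + wdot nu d).
Proof.
move=> sp.
have -> : \prod_(nu <- worbit w) (z0 + wdot nu d) = (map_poly (meval (d 0)) (orbpoly w)).[z0].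
  rewrite rmorph_prod horner_prod; apply: eq_bigr => nu _.
  by rewrite rmorphD /= map_polyX map_polyC /= hornerD hornerX hornerC meval_linform.
rewrite (horner_coef_wide _ (size_poly _ _)) /orbfac rmorph_sum /=; apply: eq_bigr => k _.
rewrite mevalM rmorphXn /= mevalXU evpt0 coef_map /=; congr (_ * _).
by rewrite (svalP (sym_lift (orbpoly_sym w k)) z0 c d sp).
Qed.

Lemma orbfac_orbital w : is_orbital_factor w (orbfac w).
Proof. by move=> z0 c d /char_poly_diag_with/meval_orbfac ->. Qed.

(** The product runs over ordered pairs: up to sign it is the square of the Vandermonde product,
    hence symmetric. *)
Definition vdm : {mpoly F[n]} := \prod_i \prod_(j | j != i) ('X_i - 'X_j).

Lemma vdm_sym : vdm \is symmetric.
Proof.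
apply/issymP => s; rewrite /vdm rmorph_prod [RHS](reindex_inj (@perm_inj _ s)) /=.
apply: eq_bigr => i _; rewrite rmorph_prod [RHS](reindex_inj (@perm_inj _ s)) /=.
rewrite [RHS](eq_bigl (fun j => j != i)) => [|j]; last by rewrite (inj_eq perm_inj).
by apply: eq_bigr => j _; rewrite msymB !msymXi.
Qed.

Lemma meval_vdm (d : 'rV[F]_n) : vdm.@[d 0] != 0 <-> injective (d 0).
Proof.
rewrite rmorph_prod /=; split=> [/prodf_neq0 h i j e|inj].
  apply/eqP/negPn/negP => ne; have := h i isT; rewrite rmorph_prod /= => /prodf_neq0/(_ j).
  by rewrite eq_sym => /(_ ne); rewrite mevalB !mevalXU e subrr eqxx.
apply/prodf_neq0 => i _; rewrite rmorph_prod /=; apply/prodf_neq0 => j ne.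
by rewrite mevalB !mevalXU subr_eq0 (inj_eq inj) eq_sym.
Qed.

Definition disc : PR F n := sval (sym_lift vdm_sym).

Lemma meval_disc z0 c d : spectrum (Lof c) d -> disc.@[evpt z0 c] = vdm.@[d 0].
Proof. exact: (svalP (sym_lift vdm_sym)). Qed.

End Evaluation.

(** * Projection onto trace-zero diagonals along the scalar ones *)

Section Center.
Variables (F : fieldType) (charF0 : [pchar F] =i pred0) (n : nat).
Implicit Types (w d : 'rV[F]_n).

Definition ctr d : 'rV[F]_n := d - const_mx ((\sum_i d 0 i) / n%:R).

Lemma sum_ctr d : \sum_i ctr d 0 i = 0.
Proof.
under eq_bigr => i _ do rewrite !mxE; rewrite sumrB sumr_const card_ord.
have [n0|n0] := posnP n.
  rewrite [X in _ *+ X]n0 mulr0n subr0 big1 // => i.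
  by have := ltn_ord i; rewrite [X in (_ < X)%N]n0.
rewrite -[_ *+ n]mulr_natr divfK ?subrr // ((pcharf0P F).1 charF0).
by rewrite -lt0n.
Qed.

Lemma ctr_id d : \sum_i d 0 i = 0 -> ctr d = d.
Proof.
by move=> sd; rewrite /ctr sd mul0r (_ : const_mx 0 = 0) ?subr0.
Qed.

Lemma wdot_ctr w d : is_weight_rep w -> wdot w (ctr d) = wdot w d.
Proof.
move=> /eqP sw; rewrite /wdot; under eq_bigr => i _ do rewrite !mxE mulrBr.
by rewrite sumrB -mulr_suml sw mul0r subr0.
Qed.

End Center.

(** * From diagonalizable matrices to polynomial identities *)

Section Density.
Variables (F : closedFieldType) (charF0 : [pchar F] =i pred0) (n N : nat).
Local Notation dsl := (dsl n).

Lemma spectrum_diag (d : 'rV[F]_n) : \sum_i d 0 i = 0 -> spectrum (Lof (cof (diag_mx d))) d.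
Proof. by move=> sd; rewrite /spectrum cofK ?in_sl_diag ?sd // char_poly_diag. Qed.

Lemma disc_neq0 : disc F n != 0.
Proof.
(* The naturals below [n], recentred: a trace-zero diagonal with distinct entries. *)
pose d : 'rV[F]_n := ctr (\row_i (i : nat)%:R).
have /(meval_disc 0) e := spectrum_diag (sum_ctr charF0 (\row_i (i : nat)%:R : 'rV[F]_n)).
apply/eqP => d0.
have /(meval_vdm d).2/negP[] : injective (d 0).
  by move=> i j; rewrite !mxE => /addIr/(natr_pchar0_inj charF0)/val_inj.
by rewrite -e d0 meval0.
Qed.

(** Where [disc] is nonzero the eigenvalues are distinct and [L] is diagonalizable. So [p] and [q]
    agree after multiplication by [disc], which is then cancelled. *)
Lemma PR_ext (p q : PR F n) :
  (forall z0 c d, diag_with (Lof c) d -> p.@[evpt z0 c] = q.@[evpt z0 c]) -> p = q.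
Proof.
move=> h; apply: (mulIf disc_neq0); apply: (mpoly_ext charF0) => v.
rewrite !(meval_eq _ (evpt_surj v)) !mevalM.
set c := fun i => v (lift ord0 i).
have [d sp] := char_poly_split (Lof c).
have [->|dn0] := eqVneq (disc F n).@[evpt (v ord0) c] 0; first by rewrite !mulr0.
congr (_ * _); rewrite (meval_disc _ sp) in dn0.
have [d' hd'] := distinct_diag_with sp ((meval_vdm d).1 dn0).
exact: h hd'.
Qed.

Lemma diag_with_sum (L : 'M[F]_n) (d : 'rV[F]_n) : in_sl L -> diag_with L d -> \sum_i d 0 i = 0.
Proof.
move=> /in_slP tL [P [uP eL]]; rewrite -mxtrace_diag -tL eL.
by rewrite mxtrace_mulC mulmxA mulmxV // mul1mx.
Qed.

(** For diagonalizable [L] the intertwiner of [invmx P] reduces the determinant to the diagonal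
    case. *)
Lemma fphi_orbfac (phi : 'M[F]_n -> 'M[F]_N)
  (Hrep : is_lie_rep phi) (Hirr : irreducible_rep phi)
  (mus : seq 'rV[F]_n) (Huniq : uniq mus)
  (Hmus : forall w, w \in mus <->
            [/\ is_weight_rep w, dominant w & (0 < wmult phi w)%N]) :
  fphi phi = \prod_(w <- mus) orbfac w ^+ wmult phi w.
Proof.
apply: PR_ext => z0 c d Ld; have sd := diag_with_sum (Lof_sl c) Ld.
rewrite meval_fphi // rmorph_prod /=.
rewrite (eq_bigr (fun w => (\prod_(nu <- worbit w) (z0 + wdot nu d)) ^+ wmult phi w));
    last first.
  by move=> w _; rewrite rmorphXn /= (meval_orbfac _ _ (char_poly_diag_with Ld)).
have [B [ws [uB ws_rep phiB]]] := weight_basis charF0 Hrep Hirr.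
rewrite -(det_phi_diag charF0 Hrep uB ws_rep phiB Huniq Hmus z0 sd).
case: Ld => P [uP ->].
have uP' : invmx P \in unitmx by rewrite unitmx_inv.
have [g ug gP] := intertwined_diag charF0 Hrep uP'.
have := gP d sd; rewrite invmxK => e.
have {}e : z0%:M + phi (invmx P *m diag_mx d *m P) = g *m (z0%:M + phi (diag_mx d)) *m invmx g.
  rewrite mulmxDr e scalar_mxC -mulmxDl mulmxK //.
by rewrite e !det_mulmx mulrAC -det_mulmx mulmxV // det1 mul1r.
Qed.

End Density.

(** * Homogeneity and degree of the orbital factor *)

Section Degree.
Variables (F : closedFieldType) (charF0 : [pchar F] =i pred0) (n : nat).
Local Notation dsl := (dsl n).
Variable w : 'rV[F]_n.

Lemma worbit_self : w \in worbit w.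
Proof. by apply/worbitP; exists 1%g; rewrite wact1. Qed.

Lemma size_worbit_gt0 : (0 < size (worbit w))%N.
Proof. by case: (worbit w) worbit_self. Qed.

Lemma LofZ a (c : 'I_dsl -> F) : Lof (fun i => a * c i) = a *: Lof c.
Proof. by rewrite /Lof scaler_sumr; apply: eq_bigr => i _; rewrite scalerA. Qed.

Lemma diag_withZ a (L : 'M[F]_n) d : diag_with L d -> diag_with (a *: L) (a *: d).
Proof.
by case=> P [uP ->]; exists P; split=> //; rewrite linearZ /= -scalemxAr -scalemxAl.
Qed.

(** Scaling by the single constant 2 suffices to detect homogeneity, as the powers of 2 are distinct
    in characteristic 0. *)
Lemma orbfac_scale : orbfac w \mPo [tuple 2%:R *: 'X_i | i < dsl.+1] =
  2%:R ^+ size (worbit w) *: orbfac w.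
Proof.
apply: (PR_ext charF0) => z0 c d Ld; rewrite comp_mpoly_meval mevalZ.
rewrite [LHS](meval_eq _ (v2 := evpt (2%:R * z0) (fun i => 2%:R * c i))); last first.
  move=> j; rewrite tnth_mktuple mevalZ mevalXU.
  by rewrite /evpt; case: (unlift ord0 j).
have L2 : diag_with (Lof (fun i => 2%:R * c i)) (2%:R *: d) by rewrite LofZ; apply: diag_withZ.
rewrite (meval_orbfac _ _ (char_poly_diag_with Ld)) (meval_orbfac _ _ (char_poly_diag_with L2)).
have wd2 nu : wdot nu (2%:R *: d) = 2%:R * wdot nu d.
  by rewrite /wdot mulr_sumr; apply: eq_bigr => i _; rewrite mxE mulrCA.
elim: (worbit w) => [|nu s IHs]; first by rewrite !big_nil expr0 mulr1.
by rewrite !big_cons IHs wd2 exprS; ring.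
Qed.

Lemma orbfac_homog m : m \in msupp (orbfac w) -> mdeg m = size (worbit w).
Proof.
rewrite mcoeff_msupp => fm; have := congr1 (mcoeff m) orbfac_scale.
have -> : orbfac w \mPo [tuple 2%:R *: 'X_i | i < dsl.+1] =
    \sum_(m' <- msupp (orbfac w)) (2%:R ^+ mdeg m' * (orbfac w)@_m') *: 'X_[m'].
  rewrite comp_mpolyE; apply: eq_bigr => m' _.
  rewrite [2%:R ^+ _ * _]mulrC -scalerA; congr (_ *: _).
  rewrite [in RHS]mpolyXE_id mdegE -prodrXr -scaler_prod /=.
  by apply: eq_bigr => i _; rewrite tnth_mktuple exprZn.
rewrite mcoeffZ raddf_sum /= (bigD1_seq m) ?msupp_uniq ?mcoeff_msupp //=.
rewrite mcoeffZ mcoeffX eqxx mulr1 big1 ?addr0 => [|m' ne]; last first.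
  by rewrite mcoeffZ mcoeffX (negPf ne) mulr0.
move/(mulIf fm); rewrite -!natrX => /(natr_pchar0_inj charF0)/eqP.
by rewrite eqn_exp2l // => /eqP.
Qed.

(** The value at [z0 = 1], [L = 0] is 1. *)
Lemma orbfac_neq0 : orbfac w != 0.
Proof.
apply/eqP => f0; have sd : \sum_i (0 : 'rV[F]_n) 0 i = 0 by rewrite big1 // => i _; rewrite mxE.
have := meval_orbfac w 1 (spectrum_diag sd); rewrite f0 meval0 => /esym/eqP.
rewrite (eq_bigr (fun=> 1)) ?big1 ?oner_eq0 // => nu _.
by rewrite /wdot big1 ?addr0 // => i _; rewrite mxE mulr0.
Qed.

Lemma msize_orbfac : msize (orbfac w) = (size (worbit w)).+1.
Proof.
rewrite -mlead_deg ?orbfac_neq0 //; congr _.+1; apply: orbfac_homog.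
by rewrite mlead_supp // orbfac_neq0.
Qed.

End Degree.

(** * Restriction of polynomials to parametrised curves *)

Section Substitution.
Variables (F : fieldType) (k : nat).

Definition psub (g : 'I_k -> {poly F}) (p : {mpoly F[k]}) : {poly F} := mmap polyC g p.

Lemma psubM g p q : psub g (p * q) = psub g p * psub g q.
Proof. exact: rmorphM. Qed.

Lemma horner_psub g p t : (psub g p).[t] = p.@[fun j => (g j).[t]].
Proof.
rewrite /psub /mmap horner_sum mevalE; apply: eq_bigr => m _.
rewrite hornerM hornerC /mmap1 horner_prod; congr (_ * _).
by apply: eq_bigr => i _; rewrite horner_exp.
Qed.

(** Bounds the number of roots in [z0] of a specialised factor by its total degree. *)
Lemma size_psub (g : 'I_k -> {poly F}) p :
  (forall j, (size (g j) <= 2)%N) -> (size (psub g p) <= msize p)%N.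
Proof.
move=> sg; rewrite /psub /mmap; apply: (leq_trans (size_sum _ _ _)).
rewrite big_seq; elim/big_ind: _ => // [a b|m /msize_mdeg_lt ltm].
  by rewrite geq_max => -> ->.
apply: leq_trans ltm; rewrite mul_polyC (leq_trans (size_scale_leq _ _)) // /mmap1 mdegE.
apply: (big_ind2 (fun (a : {poly F}) b => (size a <= b.+1)%N)).
- by rewrite size_polyC oner_eq0.
- move=> a1 b1 a2 b2 h1 h2; apply: (leq_trans (size_mul_leq _ _)).
  by move: h1 h2; case: (size a1) => [|x]; case: (size a2) => [|y] /=; lia.
- move=> i _; apply: (leq_trans (size_exp_leq _ _)); rewrite ltnS.
  rewrite -[X in (_ <= X)%N]mul1n leq_mul2r.
  by have := sg i; case: (size _) => [|[|[|]]] //=; rewrite ?orbT.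
Qed.

End Substitution.

(** * Irreducibility of the orbital factor *)

Section Irreducible.
Variables (F : closedFieldType) (charF0 : [pchar F] =i pred0) (n : nat).
Local Notation dsl := (dsl n).

(** Fixes the coordinates at [c] and keeps [z0] as the variable. *)
Definition zpoly (c : 'I_dsl -> F) (j : 'I_dsl.+1) : {poly F} :=
  if unlift ord0 j is Some i then (c i)%:P else 'X.

Lemma horner_zpoly c (p : PR F n) z0 : (psub (zpoly c) p).[z0] = p.@[evpt z0 c].
Proof.
rewrite horner_psub; apply: meval_eq => j; rewrite /zpoly /evpt.
by case: unlift => [i|]; rewrite ?hornerC ?hornerX.
Qed.

Lemma size_zpoly c j : (size (zpoly c j) <= 2)%N.
Proof. by rewrite /zpoly; case: unlift => [i|]; rewrite ?size_polyX // size_polyC; case: eqP. Qed.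

Variable w : 'rV[F]_n.
Hypothesis rw : is_weight_rep w.

(** The specialisation is a product of monic linear polynomials in [z0]. *)
Lemma psub_orbfac_neq0 c : psub (zpoly c) (orbfac w) != 0.
Proof.
have [d sp] := char_poly_split (Lof c).
have -> : psub (zpoly c) (orbfac w) = \prod_(nu <- worbit w) ('X + (wdot nu d)%:P).
  apply/eqP; rewrite -subr_eq0; apply/eqP/(poly_vanish charF0) => z0.
  rewrite hornerD hornerN horner_zpoly (meval_orbfac _ _ sp) horner_prod.
  by under [in X in _ - X]eq_bigr => nu _ do rewrite hornerD hornerX hornerC; rewrite subrr.
apply/monic_neq0/monic_prod => nu _.
by rewrite -[_%:P]opprK -polyCN monicXsubC.
Qed.

Section Factor.
Variables q r : PR F n.
Hypothesis fqr : orbfac w = q * r.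

(* For fixed [z0] and [X], [q r] is a constant polynomial in the parameter [t]
   of the conjugating one-parameter group, hence so is [q] unless [q r = 0]. *)
Lemma factor_transv (v : 'cV[F]_n) k (X : 'M[F]_n) z0 : v k 0 = 0 -> in_sl X ->
  q.@[evpt z0 (cof (transv v k *m X *m invmx (transv v k)))] = q.@[evpt z0 (cof X)].
Proof.
move=> vk sX; set c1 := cof (_ *m _ *m _).
(* The second factor disposes of the [z] at which the orbital factor vanishes; as a nonzero
   polynomial in [z] it is cancelled at the end. *)
have key z : (psub (zpoly c1) q - psub (zpoly (cof X)) q).[z] *
    (psub (zpoly (cof X)) (orbfac w)).[z] = 0.
  rewrite hornerD hornerN !horner_zpoly.
  have [->|f0] := eqVneq ((orbfac w).@[evpt z (cof X)]) 0; first by rewrite mulr0.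
  pose E := v *m delta_mx 0 k : 'M[F]_n.
  pose C := E *m X - X *m E; pose D := 2%:R^-1 *: (E *m C - C *m E).
  have EE : E *m E = 0 by apply: transv_sq0.
  have sC : in_sl C by apply: in_sl_comm.
  have sD : in_sl D by apply/in_slZ/in_sl_comm.
  (* Coordinates of the conjugate of [X] by [transv (t *: v) k], quadratic in [t]. The values
     [t = 0] and [t = 1] give the two sides of the claim. *)
  pose ct (t : F) i : F := cof X i + t * cof C i + t ^+ 2 * cof D i.
  have conjt t : X + t *: C + t ^+ 2 *: D = transv (t *: v) k *m X *m invmx (transv (t *: v) k).
    have tvk : (t *: v) k 0 = 0 by rewrite mxE vk mulr0.
    have -> : invmx (transv (t *: v) k) = 1%:M - t *: E.
      have tt := transv_mulN tvk; have [u1 _] := mulmx1_unit tt.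
      have -> : 1%:M - t *: E = transv (- (t *: v)) k by rewrite /transv mulNmx -scalemxAl.
      by apply: (can_inj (mulKmx u1)); rewrite mulmxV ?tt.
    have -> : transv (t *: v) k = 1%:M + t *: E by rewrite /transv -scalemxAl.
    have tEE : (t *: E) *m (t *: E) = 0 by rewrite -scalemxAl -scalemxAr EE !scaler0.
    have [_ ->] := conj_sq0 charF0 X tEE.
    rewrite /D /C -!scalemxAl -!scalemxAr -!scalerBr -!scalemxAl -!scalemxAr -!scalerBr.
    by congr (_ + _ + _); rewrite !scalerA; congr (_ *: _); ring.
  have Lct t : Lof (ct t) = transv (t *: v) k *m X *m invmx (transv (t *: v) k).
    rewrite -conjt -{1}(cofK sX) -(cofK sC) -(cofK sD).
    rewrite /Lof !scaler_sumr -!big_split /=; apply: eq_bigr => i _.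
    by rewrite /ct !scalerDl !scalerA.
  pose g (j : 'I_dsl.+1) : {poly F} := if unlift ord0 j is Some i
    then (cof X i)%:P + (cof C i) *: 'X + (cof D i) *: 'X^2 else z%:P.
  have gE p t : (psub g p).[t] = p.@[evpt z (ct t)].
    rewrite horner_psub; apply: meval_eq => j; rewrite /g /evpt.
    case: unlift => [i|]; rewrite ?hornerC //.
    by rewrite !hornerD !hornerZ hornerXn hornerX hornerC /ct [t * _]mulrC [t ^+ 2 * _]mulrC.
  have fconst : psub g (orbfac w) = ((orbfac w).@[evpt z (cof X)])%:P.
    apply/eqP; rewrite -subr_eq0; apply/eqP/(poly_vanish charF0) => t.
    have [d sp] := char_poly_split X.
    have spX : spectrum (Lof (cof X)) d by rewrite cofK.
    have spt : spectrum (Lof (ct t)) d.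
      have tvk : (t *: v) k 0 = 0 by rewrite mxE vk mulr0.
      have [u1 _] := mulmx1_unit (transv_mulN tvk).
      by rewrite /spectrum Lct -[X in X *m _ *m _]invmxK char_poly_conj ?unitmx_inv.
    rewrite hornerD hornerN hornerC gE (meval_orbfac _ _ spt) (meval_orbfac _ _ spX).
    by rewrite subrr.
  (* A factor of a nonzero constant polynomial is constant. *)
  have qconst : (size (psub g q) <= 1)%N.
    have : psub g q * psub g r = ((orbfac w).@[evpt z (cof X)])%:P by rewrite -psubM -fqr.
    move=> e; have n0 : psub g q * psub g r != 0 by rewrite e polyC_eq0.
    have := congr1 (fun p : {poly F} => size p) e; rewrite size_polyC f0.
    move: n0; rewrite mulf_eq0 negb_or => /andP[q0 r0]; rewrite size_mul //.
    move: q0 r0; rewrite -!size_poly_gt0.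
    by case: (size (psub g q)) => [|[|a]] //; case: (size (psub g r)) => [|b] // _ _; rewrite addnS.
  have e1 : q.@[evpt z c1] = (psub g q).[1].
    rewrite gE; apply: meval_eq; apply: eq_evpt => i.
    by rewrite -(LofK (ct 1)) Lct scale1r.
  have e0 : q.@[evpt z (cof X)] = (psub g q).[0].
    by rewrite gE; apply: meval_eq; apply: eq_evpt => i; rewrite /ct expr0n /= !mul0r !addr0.
  by rewrite e1 e0 (size1_polyC qconst) !hornerC subrr mul0r.
have : (psub (zpoly c1) q - psub (zpoly (cof X)) q) * psub (zpoly (cof X)) (orbfac w) = 0.
  by apply: (poly_vanish charF0) => z; rewrite hornerM.
move/eqP; rewrite mulf_eq0 (negPf (psub_orbfac_neq0 _)) orbF subr_eq0 => /eqP e.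
by rewrite -!horner_zpoly e.
Qed.

(** Permuting a diagonal is conjugation by a permutation matrix, which on diagonals agrees with a
    product of transvections. *)
Lemma factor_wact s (d : 'rV[F]_n) z0 : \sum_i d 0 i = 0 ->
  q.@[evpt z0 (cof (diag_mx (wact s d)))] = q.@[evpt z0 (cof (diag_mx d))].
Proof.
move=> sd; pose K T := forall X z, in_sl X ->
  q.@[evpt z (cof (T *m X *m invmx T))] = q.@[evpt z (cof X)].
have [|||T KT TP] := @conj_diag_transvections F n K _ _ _ _ (unitmx_perm F s).
- by move=> X z sX; rewrite invmx1 mulmx1 mul1mx.
- move=> A B uA uB KA KB X z sX; rewrite invmxM //.
  rewrite -(KB X z sX) -(KA _ z (in_sl_conj uB sX)); congr (_.@[evpt _ (cof _)]).
  by rewrite !mulmxA.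
- by move=> v k vk X z sX; apply: factor_transv.
by rewrite -perm_diag_conj -TP KT // in_sl_diag sd.
Qed.

(* Substitutes [z0 := - w(L)] and a generic diagonal traceless [L]. *)
Definition Theta : dsl.+1.-tuple {mpoly F[n]} :=
  [tuple if unlift ord0 j is Some i
         then \sum_(l < n) (cof (diag_mx (ctr (delta_mx 0 l))) i) *: 'X_l
         else - linform w | j < dsl.+1].

Lemma ctr_sum (d : 'rV[F]_n) : ctr d = \sum_l d 0 l *: ctr (delta_mx 0 l).
Proof.
under eq_bigr => l _ do rewrite /ctr scalerBr; rewrite sumrB -row_sum_delta; congr (_ - _).
apply/rowP => i; rewrite !mxE summxE mulr_suml; apply: eq_bigr => l _; rewrite !mxE.
rewrite (bigD1 l) //= mxE !eqxx big1 ?addr0 ?mul1r // => j /negPf ne.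
by rewrite mxE ne andbF.
Qed.

Lemma meval_Theta (p : PR F n) (d : 'rV[F]_n) :
  (p \mPo Theta).@[d 0] = p.@[evpt (- wdot w d) (cof (diag_mx (ctr d)))].
Proof.
rewrite comp_mpoly_meval; apply: meval_eq => j; rewrite tnth_mktuple /evpt.
case: unlift => [i|]; last by rewrite mevalN meval_linform.
rewrite rmorph_sum /= [in RHS]ctr_sum linear_sum cof_sum /=; apply: eq_bigr => l _.
by rewrite mevalZ mevalXU linearZ /= cofZ mulrC.
Qed.

(** The linear factor belonging to [w] itself becomes zero. *)
Lemma Theta_orbfac : orbfac w \mPo Theta = 0.
Proof.
apply: (mpoly_vanish charF0) => v; pose d : 'rV[F]_n := \row_i v i.
rewrite (meval_eq _ (v2 := d 0)) => [|i]; last by rewrite mxE.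
rewrite meval_Theta (meval_orbfac _ _ (spectrum_diag (sum_ctr charF0 d))).
by rewrite (bigD1_seq w) ?worbit_self ?undup_uniq //= wdot_ctr // addNr mul0r.
Qed.

(** Where it is nonzero, the weights of the orbit take distinct values. *)
Definition sepform : {mpoly F[n]} := \prod_(nu <- worbit w)
  \prod_(nu' <- worbit w | nu' != nu) (linform nu - linform nu').

Lemma linform_inj : injective (@linform F n).
Proof.
move=> u v e; apply/rowP => i.
have := meval_linform u (delta_mx 0 i); rewrite e meval_linform /wdot.
have h (x : 'rV[F]_n) : \sum_j x 0 j * (delta_mx 0 i : 'rV[F]_n) 0 j = x 0 i.
  rewrite (bigD1 i) //= mxE !eqxx mulr1 big1 ?addr0 // => j /negPf ne.
  by rewrite mxE ne andbF mulr0.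
by rewrite !h.
Qed.

Lemma sepform_neq0 : sepform != 0.
Proof.
rewrite prodf_seq_neq0; apply/allP => nu _ /=; rewrite prodf_seq_neq0; apply/allP => nu' _ /=.
by apply/implyP => ne; rewrite subr_eq0 (inj_eq linform_inj) eq_sym.
Qed.

(** At a diagonal where the orbit is separated, [q] has one root in [z0] for each weight of the
    orbit. So [q] has at least the degree of the whole product, and [r] is a nonzero constant. *)
Lemma Theta_factor_unit : q \mPo Theta = 0 -> r \is a GRing.unit.
Proof.
move=> qT; apply/negPn/negP => nr; apply: (mpoly_nonvanish charF0 sepform_neq0) => v.
apply/negPn/negP => sv; case/negP: nr; pose d0 : 'rV[F]_n := \row_i v i; pose d := ctr d0.
have sd : \sum_i d 0 i = 0 by apply: sum_ctr.
have q0 (d' : 'rV[F]_n) : \sum_i d' 0 i = 0 -> q.@[evpt (- wdot w d') (cof (diag_mx d'))] = 0.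
  by move=> sd'; have := meval_Theta q d'; rewrite qT meval0 ctr_id // => <-.
pose rs := [seq - wdot nu d | nu <- worbit w].
have urs : uniq rs.
  rewrite map_inj_in_uniq ?undup_uniq // => nu nu' win win' /oppr_inj.
  have wr x : x \in worbit w -> wdot x d = wdot x d0.
    by move=> xw; apply: wdot_ctr; rewrite /is_weight_rep (worbit_sum xw).
  rewrite !wr // => e; apply/eqP/negPn/negP => ne; case/negP: sv.
  rewrite (meval_eq _ (v2 := d0 0)) => [|i]; last by rewrite mxE.
  rewrite rmorph_prod /= prodf_seq_eq0; apply/hasP; exists nu => //=.
  rewrite rmorph_prod /= prodf_seq_eq0; apply/hasP; exists nu' => //=.
  by rewrite eq_sym ne /= mevalB !meval_linform e subrr.
pose qd := psub (zpoly (cof (diag_mx d))) q.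
have qd0 : qd != 0.
  by have := psub_orbfac_neq0 (cof (diag_mx d)); rewrite fqr psubM mulf_eq0 negb_or => /andP[].
have rt : all (root qd) rs.
  apply/allP => _ /mapP[_ /worbitP[s ->] ->]; rewrite rootE horner_zpoly; apply/eqP.
  have [d' e sd'] : exists2 d', d = wact s d' & \sum_i d' 0 i = 0.
    by exists (wact s^-1%g d); rewrite ?wactKV ?sum_act.
  (* Invariance moves the root attached to [wact s w] at [d] to the one attached to [w] at [d'],
     which is known to be a zero of [q]. *)
  by rewrite e wdot_act factor_wact // q0.
have := max_poly_roots qd0 rt urs; rewrite size_map => lts.
have {}lts := leq_trans lts (size_psub q (size_zpoly (cof (diag_mx d)))).
have f0 := orbfac_neq0 w.
have [qn0 rn0] : q != 0 /\ r != 0.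
  by move: f0; rewrite fqr mulf_eq0 negb_or => /andP[].
have := msize_orbfac charF0 w; rewrite fqr msizeM // => e.
have r1 : (msize r <= 1)%N.
  (* The two [msize] add up to the orbit size plus 2, and that of [q] exceeds the orbit size. *)
  by move: e lts; move: (msize q) (msize r) (size _) => x y z; lia.
have rC := msize1_polyC r1.
have c0 : r@_0 != 0 by apply: contraNneq rn0 => c0; rewrite rC c0 mpolyC0.
by rewrite rC; apply/andP; rewrite mcoeffC eqxx mulr1 unitfE.
Qed.

End Factor.

Lemma irreducible_orbfac : irreducible_elt (orbfac w).
Proof.
have f0 := orbfac_neq0 w; split=> //; split.
  (* A unit is a constant, whereas the total degree is the orbit size, which is positive. *)
  apply/negP => /andP[/eqP fC _]; have e := msize_orbfac charF0 w.
  by rewrite fC msizeC in e; move: e (size_worbit_gt0 w); case: (_ != 0) => // -[<-].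
move=> q r fqr; have := Theta_orbfac; rewrite fqr rmorphM /= => /eqP.
rewrite mulf_eq0 => /orP[/eqP qT|/eqP rT].
  by right; apply: (Theta_factor_unit fqr).
by left; apply: (@Theta_factor_unit r q) => //; rewrite mulrC.
Qed.

End Irreducible.

Theorem theorem3p12 (F : closedFieldType) (charF0 : [pchar F] =i pred0)
  (n N : nat) (phi : 'M[F]_n -> 'M[F]_N)
  (Hrep : is_lie_rep phi) (Hirr : irreducible_rep phi)
  (mus : seq 'rV[F]_n) (Huniq : uniq mus)
  (Hmus : forall w, w \in mus <->
            [/\ is_weight_rep w, dominant w & (0 < wmult phi w)%N]) :
  exists f : 'rV[F]_n -> PR F n,
    fphi phi = \prod_(w <- mus) f w ^+ wmult phi w /\
    forall w, w \in mus ->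
      [/\ is_orbital_factor w (f w),
          irreducible_elt (f w) &
          msize (f w) = (size (worbit w)).+1].
Proof.
exists (@orbfac F n); split; first exact: fphi_orbfac.
move=> w /Hmus[rw _ _]; split.
- exact: orbfac_orbital.
- exact: irreducible_orbfac.
- exact: msize_orbfac.
Qed.
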